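(* Let the Structural Assumptions (A1)–(A8) listed in the context hold with some reflexive space $U$ continuously embedded in $L^p(\Omega)$ for some $1\le p\le\infty$, let $A:U\to U^*$ be an isomorphism, $f_0\in L^{p/(p-1)}(\Omega)$ and $f_1\in U^*$. Consider the problems $$(\mathrm{I}_{\delta\tau})\qquad \min_{u\in U,\,w}\ \|Tu-y^\delta\|_Y\quad\text{subject to}\quad Au+f_0(P_\tau u)(P_\tau w)=f_1,\ \ w\in W^{\mathrm{ad}}_h$$ and $$(\mathrm{McC}_{\delta\tau})\qquad \min_{u\in U,\,w,\,z}\ \|Tu-y^\delta\|_Y\quad\text{subject to}\quad Au+f_0z=f_1,\ \ \mathrm{mcc}^i_\tau(u,w,z)\le0\ \text{a.e. in }Q_\tau^i,\ i=1,\dots,N_\tau,\ \ w\in\mathrm{conv}\,W^{\mathrm{ad}}_h,\ z\in Z^{\mathrm{ad}}_\tau,$$ where $\mathrm{mcc}^i_\tau(u,w,z)\le 0$ denotes the four inequalities given in the context. Then $(\mathrm{McC}_{\delta\tau})$ is a convex minimization problem that admits a minimizer. If $(u,w)\in U\times W^{\mathrm{ad}}_h$ is feasible for $(\mathrm{I}_{\delta\tau})$, then $(u,w,(P_\tau u)(P_\tau w))\in U\times W^{\mathrm{ad}}_h\times Z^{\mathrm{ad}}_\tau$ is feasible for $(\mathrm{McC}_{\delta\tau})$ and the objective values coincide.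
   Context: Setting. $\Omega\subset\mathbb{R}^d$, $d\in\mathbb{N}$, is a bounded Lipschitz domain; $U$ is continuously embedded in $L^2(\Omega)$; $A$ is linear; $T:L^2(\Omega)\to Y$ is a bounded linear observation operator into a Banach space $Y$; $y^\delta\in Y$; $f_0\ge0$. $w_\ell,w_u\in L^\infty(\Omega)$ are given, and $W^{\mathrm{ad}}$ is a nonempty subset of $\{w\in L^\infty(\Omega): w_\ell\le w\le w_u \text{ a.e. in }\Omega\}$. Meshes and projections. $\mathcal{Q}_h=\{Q_h^1,\dots,Q_h^{N_h}\}$ and $\mathcal{Q}_\tau=\{Q_\tau^1,\dots,Q_\tau^{N_\tau}\}$ are finite partitions of $\Omega$ with mesh sizes $h$ and $\tau$. $V_h$ is the discretization set for $w$, defined on $\mathcal{Q}_h$, and $W^{\mathrm{ad}}_h=W^{\mathrm{ad}}\cap V_h$. $P_{V_h}$ and $P_{W_h^{\mathrm{ad}}}$ are the $L^2(\Omega)$-metric projections onto $V_h$ and $W^{\mathrm{ad}}_h$. $P_\tau$ is local averaging: $(P_\tau v)|_{Q_\tau^i}=|Q_\tau^i|^{-1}\int_{Q_\tau^i}v\,dx$. State equations: (E) $Au+f_0uw=f_1$; (E$_\tau$) $Au+f_0(P_\tau u)(P_\tau w)=f_1$. Locally averaged McCormick inequalities. With $u_\ell^i,u_u^i,w_\ell^i,w_u^i$ from (A4), (A5) below and $z_i$ the constant value of $z$ on $Q_\tau^i$, $\mathrm{mcc}^i_\tau(u,w,z)\le0$ means: $u^i_\ell P_\tau w+w^i_\ell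 P_\tau u-u^i_\ell w^i_\ell-z_i\le0$, $\ u^i_uP_\tau w+w^i_uP_\tau u-u^i_uw^i_u-z_i\le0$, $\ z_i-u^i_uP_\tau w-w^i_\ell P_\tau u+u^i_uw^i_\ell\le0$, $\ z_i-u^i_\ell P_\tau w-w^i_uP_\tau u+u^i_\ell w^i_u\le0$. Structural Assumptions. (A1) $V_h$ is a closed convex subset of a finite-dimensional ansatz space for $L^2(\Omega)$. (A2) For all $w\in W^{\mathrm{ad}}$, (E) and (E$_\tau$) admit unique solutions in $U$. (A3) There are $u_\ell,u_u\in L^\infty(\Omega)$ such that for all $w\in W^{\mathrm{ad}}$ the solution $u$ of (E) satisfies $u_\ell\le u\le u_u$ a.e. in $\Omega$. (A4) There are $u_\ell^i,u_u^i\in\mathbb{R}$ such that for all $w\in W^{\mathrm{ad}}$ the solution $u$ of (E$_\tau$) satisfies $u_\ell^i\le P_\tau u\le u_u^i$ a.e. in $Q_\tau^i$, $i=1,\dots,N_\tau$. (A5) There are $w_\ell^i,w_u^i\in\mathbb{R}$ such that for all $w\in W^{\mathrm{ad}}_h$, $w_\ell^i\le P_\tau w\le w_u^i$ a.e. in $Q_\tau^i$, $i=1,\dots,N_\tau$. (A6) $P_{V_h}w=P_{W^{\mathrm{ad}}_h}w$ for all $w\in W^{\mathrm{ad}}$. (A7) $Z^{\mathrm{ad}}$ is a closed, convex, bounded subset of $L^\infty(\Omega)$, and $uw\in Z^{\mathrm{ad}}$ whenever $u$ solves (E) for $w\in W^{\mathrm{ad}}_h$. (A8) $Z^{\mathrm{ad}}_\tau$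 is a closed, convex, bounded subset of $L^\infty(\Omega)$ consisting of piecewise constant functions on $\mathcal{Q}_\tau$, and $(P_\tau u)(P_\tau w)\in Z^{\mathrm{ad}}_\tau$ whenever $u$ solves (E$_\tau$) for $w\in W^{\mathrm{ad}}_h$. *)

(* Defs.v *)
From HB Require Import structures.
From mathcomp Require Import all_boot all_order all_algebra.
From mathcomp Require Import all_classical all_reals all_analysis.
From mathcomp Require Import measurable_realfun ess_sup_inf.
Set Implicit Arguments.
Unset Strict Implicit.
Unset Printing Implicit Defensive.
Import Order.TTheory GRing.Theory Num.Theory.
Import numFieldNormedType.Exports.
Local Open Scope classical_set_scope.
Local Open Scope ring_scope.

Definition measure_rV_display : measure_display -> measure_display.
Proof. exact. Qed.

(* The Borel sigma-algebra of R^d, generated by the coordinate maps. *)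
Section measurable_rV.
Context {R : realType} (n : nat).

Let coord (i : 'I_n) (x : 'rV[R]_n) : measurableTypeR R := x ord0 i.

Let rV_set0 : g_sigma_preimage coord set0.
Proof. exact: sigma_algebra0. Qed.

Let rV_setC A : g_sigma_preimage coord A -> g_sigma_preimage coord (~` A).
Proof. exact: sigma_algebraC. Qed.

Let rV_bigcup (F : _^nat) : (forall i, g_sigma_preimage coord (F i)) ->
  g_sigma_preimage coord (\bigcup_i (F i)).
Proof. exact: sigma_algebra_bigcup. Qed.

HB.instance Definition _ :=
  @isMeasurable.Build (measure_rV_display default_measure_display)
    'rV[R]_n (g_sigma_preimage coord) rV_set0 rV_setC rV_bigcup.

Lemma measurable_coord (i : 'I_n) :
  measurable_fun [set: 'rV[R]_n] (fun x : 'rV[R]_n => x ord0 i : measurableTypeR R).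
Proof.
move=> _ Y mY; rewrite setTI; apply: sub_sigma_algebra => /=.
rewrite -bigcup_seq/=; exists i => /=; first by rewrite mem_index_enum.
by exists Y => //; rewrite setTI.
Qed.

Lemma measurable_rVP d (T : measurableType d) (f : T -> 'rV[R]_n) :
  (forall i, measurable_fun [set: T] (fun x => f x ord0 i : measurableTypeR R)) ->
  measurable_fun [set: T] f.
Proof.
move=> mf; have h : g_sigma_preimage (fun i => coord i \o f) `<=` measurable.
  apply: smallest_sub; first exact: sigma_algebra_measurable.
  rewrite -bigcup_seq/=; apply: bigcup_sub => i _.
  by move=> A [B mB <-]; apply: mf.
move=> _ A mA; apply: h; rewrite g_sigma_preimage_comp.
by exists A.
Qed.

Lemma measurable_box (A : 'I_n -> set (measurableTypeR R)) : (forall i, measurable (A i)) ->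
  measurable [set x : 'rV[R]_n | forall i, A i (x ord0 i)].
Proof.
move=> mA; rewrite (_ : [set x | _] =
    \big[setI/setT]_(i < n) ((fun x : 'rV[R]_n => x ord0 i) @^-1` (A i))).
  apply: bigsetI_measurable => i _; rewrite -[X in measurable X]setTI.
  by apply: measurable_coord => //; exact: mA.
apply/seteqP; split => x /=.
  by move=> Ax; rewrite -bigcap_seq => i _ /=; exact: Ax.
by rewrite -bigcap_seq => + i => /(_ i); apply; rewrite /= mem_index_enum.
Qed.

Lemma open_measurable_rV (U : set 'rV[R]_n) : open U -> measurable U.
Proof.
move=> oU.
pose B (qk : 'rV[rat]_n * nat) : set 'rV[R]_n :=
  [set x | forall i, ball (ratr (qk.1 ord0 i) : R) (qk.2.+1%:R^-1) (x ord0 i)].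
rewrite (_ : U = \bigcup_(qk in [set qk | B qk `<=` U]) B qk).
  rewrite bigcup_mkcond; apply: countable_bigcupT_measurable => [//|qk].
  case: ifPn => // _.
  apply: (@measurable_box
    (fun i => ball (ratr (qk.1 ord0 i) : R) (qk.2.+1%:R^-1) : set (measurableTypeR R))) => i.
  by rewrite ball_itv; exact: measurable_itv.
apply/seteqP; split; last by move=> x [qk /= + xB]; exact.
move=> x Ux; have /nbhs_ballP[e/= e0 eU] : nbhs x U by exact: open_nbhs_nbhs.
have [k ke] : exists k, (k.+1%:R^-1 : R) < e / 2.
  near \oo => k; exists k; near: k.
  by apply: (near_infty_natSinv_lt (PosNum _)); rewrite divr_gt0.
have /choice[q qx] : forall i : 'I_n, exists q : rat,
    ball (ratr q : R) k.+1%:R^-1 (x ord0 i).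
  move=> i; have /rat_in_itvoo[q] : x ord0 i - k.+1%:R^-1 < x ord0 i + k.+1%:R^-1.
    by rewrite ltrD2l gtrN ?invr_gt0.
  by rewrite in_itv/= => h; exists q; rewrite /ball/= ltr_distl.
exists (\row_i q i, k) => /=; last by move=> i /=; rewrite mxE.
move=> y By; apply: eU; split => // i j; rewrite ord1.
have := By j; have := qx j; rewrite /= mxE /ball/= => h1 h2.
rewrite (le_lt_trans (ler_distD (ratr (q j)) _ _))// (splitr e) ltrD//.
  by rewrite distrC (lt_trans h1).
by rewrite (lt_trans h2).
Unshelve. all: by end_near. Qed.

End measurable_rV.

Section lebesgue_measure_rV.
Context {R : realType}.

Definition rV_cons n (x : measurableTypeR R * 'rV[R]_n) : 'rV[R]_n.+1 :=
  \row_i oapp (x.2 ord0) x.1 (unlift ord0 i).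

Definition rV_uncons n (x : 'rV[R]_n.+1) : measurableTypeR R * 'rV[R]_n :=
  (x ord0 ord0, \row_i x ord0 (lift ord0 i)).

Lemma rV_consK n : cancel (@rV_cons n) (@rV_uncons n).
Proof.
move=> [x y]; rewrite /rV_uncons mxE unlift_none/=; congr (_, _).
by apply/rowP => i; rewrite !mxE liftK.
Qed.

Lemma measurable_rV_cons n :
  measurable_fun [set: measurableTypeR R * 'rV[R]_n] (@rV_cons n).
Proof.
apply: measurable_rVP => i.
case: (unliftP ord0 i) => [j ij|i0].
  rewrite (_ : (fun x => _) = (fun x : 'rV[R]_n => x ord0 j : measurableTypeR R) \o snd).
    by apply: measurableT_comp => //; exact: measurable_coord.
  by apply/funext => x; rewrite mxE ij liftK.
rewrite (_ : (fun x => _) = fst)//.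
by apply/funext => x; rewrite mxE i0 unlift_none.
Qed.

Lemma measurable_rV_uncons n : measurable_fun setT (@rV_uncons n).
Proof.
apply/measurable_fun_pair; first exact: measurable_coord.
apply: measurable_rVP => i; under eq_fun do rewrite mxE.
exact: measurable_coord.
Qed.

Section cons.
Variables (n : nat) (m : {sigma_finite_measure set 'rV[R]_n -> \bar R}).

Definition lebesgue_measure_cons : set 'rV[R]_n.+1 -> \bar R :=
  pushforward (@lebesgue_measure R \x m)%E (@rV_cons n).

Let preim_measurable (A : set 'rV[R]_n.+1) :
  measurable A -> measurable (@rV_cons n @^-1` A).
Proof. by move=> mA; rewrite -[X in measurable X]setTI; exact: measurable_rV_cons. Qed.

Let cons0 : lebesgue_measure_cons set0 = 0%E.
Proof. by rewrite /lebesgue_measure_cons /pushforward preimage_set0 measure0. Qed.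

Let cons_ge0 A : (0 <= lebesgue_measure_cons A)%E.
Proof. exact: (@measure_ge0 _ _ _ (@lebesgue_measure R \x m)%E). Qed.

Let cons_sigma_additive : semi_sigma_additive lebesgue_measure_cons.
Proof.
move=> F mF tF mUF; rewrite /lebesgue_measure_cons /pushforward preimage_bigcup.
apply: measure_semi_sigma_additive.
- by move=> i; exact: preim_measurable.
- apply/trivIsetP => /= i j _ _ ij; rewrite -preimage_setI.
  by move/trivIsetP : tF => /(_ _ _ _ _ ij) ->//; rewrite preimage_set0.
- by rewrite -preimage_bigcup; exact: preim_measurable.
Qed.

HB.instance Definition _ := isMeasure.Build _ _ _ lebesgue_measure_cons
  cons0 cons_ge0 cons_sigma_additive.

Let uncons_measurable (A : set (measurableTypeR R * 'rV[R]_n)) :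
  measurable A -> measurable (@rV_uncons n @^-1` A).
Proof.
by move=> mA; rewrite -[X in measurable X]setTI; exact: measurable_rV_uncons.
Qed.

Let lebesgue_measure_unconsE (A : set (measurableTypeR R * 'rV[R]_n)) :
  lebesgue_measure_cons (@rV_uncons n @^-1` A) = (@lebesgue_measure R \x m)%E A.
Proof.
rewrite /lebesgue_measure_cons /pushforward -comp_preimage; congr (_ _).
by apply/seteqP; split=> x /=; rewrite rV_consK.
Qed.

Let cons_sigma_finite : sigma_finite setT lebesgue_measure_cons.
Proof.
have /sigma_finiteP[F [TF ndF Foo]] := sigma_finiteT (@lebesgue_measure R).
have /sigma_finiteP[G [TG ndG Goo]] := sigma_finiteT m.
exists (fun n => @rV_uncons _ @^-1` (F n `*` G n)).
  rewrite -preimage_bigcup -[LHS](preimage_setT (@rV_uncons n)); congr (_ @^-1` _).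
  rewrite -setXTT TF TG predeqE => -[x y]; split.
    move=> [/= [i _ Fnx] [k _ Gky]]; exists (maxn i k) => //; split.
    - by move: x Fnx; exact/subsetPset/ndF/leq_maxl.
    - by move: y Gky; exact/subsetPset/ndG/leq_maxr.
  by move=> [i _ []/= ? ?]; split; exists i.
move=> k; have [? ?] := Foo k; have [? ?] := Goo k.
split; first by apply: uncons_measurable; exact: measurableX.
rewrite lebesgue_measure_unconsE product_measure1E//.
by rewrite lte_mul_pinfty// ge0_fin_numE.
Qed.

HB.instance Definition _ := Measure_isSigmaFinite.Build _ _ _
  lebesgue_measure_cons cons_sigma_finite.

Lemma lebesgue_measure_cons_setX (A : set (measurableTypeR R)) (B : set 'rV[R]_n) :
  measurable A -> measurable B ->
  lebesgue_measure_cons (@rV_uncons n @^-1` (A `*` B)) = (lebesgue_measure A * m B)%E.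
Proof. by move=> mA mB; rewrite lebesgue_measure_unconsE product_measure1E. Qed.

End cons.

(* Lebesgue measure on R^n as an iterated product; see lebesgue_measure_box. *)
Fixpoint lebesgue_measure_rV n : {sigma_finite_measure set 'rV[R]_n -> \bar R} :=
  match n with
  | 0 => \d_ (0 : 'rV[R]_0)
  | n.+1 => lebesgue_measure_cons (lebesgue_measure_rV n)
  end.

Lemma lebesgue_measure_box n (A : 'I_n -> set (measurableTypeR R)) :
  (forall i, measurable (A i)) ->
  lebesgue_measure_rV n [set x | forall i, A i (x ord0 i)] =
  (\prod_(i < n) lebesgue_measure (A i))%E.
Proof.
elim: n A => [|n ih] A mA.
  rewrite big_ord0 /= diracE mem_set//; case; by [].
rewrite big_ord_recl -ih; last by move=> i; exact: mA.
rewrite -lebesgue_measure_cons_setX//; last first.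
  exact: (@measurable_box _ _ (fun i => A (lift ord0 i))).
congr (_ _); apply/seteqP; split => x /=.
  by move=> Ax; split => // i; rewrite mxE.
by move=> [A0 A1] i; case: (unliftP ord0 i) => [j|] ->//; have := A1 j; rewrite mxE.
Qed.
End lebesgue_measure_rV.

Lemma filterS4 (I : Type) (F : set_system I) : Filter F ->
  forall P Q R S U : set I, (forall x, P x -> Q x -> R x -> S x -> U x) ->
  F P -> F Q -> F R -> F S -> F U.
Proof.
move=> FF P Q R S U h FP FQ FR FS.
by apply: (filterS2 _ _ (filterI FP FQ) (filterI FR FS)) => x [? ?] [? ?]; exact: h.
Qed.

Lemma filterS5 (I : Type) (F : set_system I) : Filter F ->
  forall P Q R S U V : set I, (forall x, P x -> Q x -> R x -> S x -> U x -> V x) ->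
  F P -> F Q -> F R -> F S -> F U -> F V.
Proof.
move=> FF P Q R S U V h FP FQ FR FS FU.
by apply: (filterS3 _ _ (filterI FP FQ) (filterI FR FS) FU) => x [? ?] [? ?]; exact: h.
Qed.

(* Algebra structure on measurable functions modulo equality almost everywhere.
   measurableTypeR R is the codomain used by LspaceType. *)
Section L0.
Context d (T : measurableType d) (R : realType) (mu : {measure set T -> \bar R}).

Local Notation L0 := (@aeEqMfun _ _ R T (measurableTypeR R) mu).
Implicit Types (f g h : L0) (a b : R).

Lemma L0_measurable f : measurable_fun [set: T] (f : T -> R).
Proof. exact: (@measurable_funPT _ _ _ _ (repr f)). Qed.

Definition L0_of (f : T -> R) (mf : measurable_fun [set: T] f) : L0 :=
  \pi_(L0)%qT (@mfun_Sub _ _ T (measurableTypeR R) f (mem_set mf)).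

Lemma L0_ofE (f : T -> R) (mf : measurable_fun [set: T] f) :
  L0_of mf = f %[ae mu].
Proof.
apply/asboolP; rewrite -[`[< _ >]]/(ae_eq_op mu (repr (L0_of mf))
  (@mfun_Sub _ _ T (measurableTypeR R) f (mem_set mf))).
by apply/eqmodP; rewrite reprK.
Qed.

Lemma L0P f g : (f : T -> R) = g %[ae mu] -> f = g.
Proof.
move=> fg; rewrite -[f]reprK -[g]reprK; apply/eqmodP.
exact/asboolP.
Qed.

Definition L0_zero : L0 := L0_of (@measurable_cst _ _ T R setT 0).
Definition L0_one : L0 := L0_of (@measurable_cst _ _ T R setT 1).
Let measurable_oppL0 f : measurable_fun [set: T] (\- (f : T -> R)).
Proof. by apply/measurable_funN; exact: L0_measurable. Qed.

Definition L0_opp f : L0 := L0_of (measurable_oppL0 f).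
Definition L0_add f g : L0 := L0_of (measurable_funD (L0_measurable f) (L0_measurable g)).
Definition L0_mul f g : L0 := L0_of (measurable_funM (L0_measurable f) (L0_measurable g)).
Definition L0_scale a f : L0 :=
  L0_of (measurable_funM (@measurable_cst _ _ T R setT a) (L0_measurable f)).

Let addE f g : (L0_add f g : T -> R) = (f : T -> R) \+ g %[ae mu].
Proof. exact: L0_ofE. Qed.

Let oppE f : (L0_opp f : T -> R) = \- (f : T -> R) %[ae mu].
Proof. exact: L0_ofE. Qed.

Let mulE f g : (L0_mul f g : T -> R) = (f : T -> R) \* g %[ae mu].
Proof. exact: L0_ofE. Qed.

Let scaleE a f : (L0_scale a f : T -> R) = (fun x => a * (f x : R)) %[ae mu].
Proof. exact: L0_ofE. Qed.

Let addA : associative L0_add.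
Proof.
move=> f g h; apply: L0P.
apply: (filterS4 _ _ (addE f (L0_add g h)) (addE g h) (addE (L0_add f g) h) (addE f g)).
by move=> x e1 e2 e3 e4 _; rewrite e1// e3//= e2// e4//= addrA.
Qed.

Let addC : commutative L0_add.
Proof.
move=> f g; apply: L0P; apply: (filterS2 _ _ (addE f g) (addE g f)).
by move=> x e1 e2 _; rewrite e1// e2//= addrC.
Qed.

Let add0 : left_id L0_zero L0_add.
Proof.
move=> f; apply: L0P.
apply: (filterS2 _ _ (addE L0_zero f) (L0_ofE (@measurable_cst _ _ T R setT 0))).
by move=> x e1 e2 _; rewrite e1//= e2//= add0r.
Qed.

Let addN : left_inverse L0_zero L0_opp L0_add.
Proof.
move=> f; apply: L0P.
apply: (filterS3 _ _ (addE (L0_opp f) f) (oppE f) (L0_ofE (@measurable_cst _ _ T R setT 0))).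
by move=> x e1 e2 e3 _; rewrite e1//= e2//= e3//= addNr.
Qed.

HB.instance Definition _ := GRing.isZmodule.Build L0 addA addC add0 addN.

Let mulA : associative L0_mul.
Proof.
move=> f g h; apply: L0P.
apply: (filterS4 _ _ (mulE f (L0_mul g h)) (mulE g h) (mulE (L0_mul f g) h) (mulE f g)).
by move=> x e1 e2 e3 e4 _; rewrite e1// e3//= e2// e4//= mulrA.
Qed.

Let mulC : commutative L0_mul.
Proof.
move=> f g; apply: L0P; apply: (filterS2 _ _ (mulE f g) (mulE g f)).
by move=> x e1 e2 _; rewrite e1// e2//= mulrC.
Qed.

Let mul1 : left_id L0_one L0_mul.
Proof.
move=> f; apply: L0P.
apply: (filterS2 _ _ (mulE L0_one f) (L0_ofE (@measurable_cst _ _ T R setT 1))).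
by move=> x e1 e2 _; rewrite e1//= e2//= mul1r.
Qed.

Let mulDl : left_distributive L0_mul L0_add.
Proof.
move=> f g h; apply: L0P.
apply: (filterS5 _ _ (mulE (L0_add f g) h) (addE f g) (addE (L0_mul f h) (L0_mul g h)) (mulE f h) (mulE g h)).
by move=> x e1 e2 e3 e4 e5 _; rewrite e1//= e2//= e3//= e4//= e5//= mulrDl.
Qed.

HB.instance Definition _ :=
  GRing.Zmodule_isComPzRing.Build L0 mulA mulC mul1 mulDl.

Let scaleA a b f : L0_scale a (L0_scale b f) = L0_scale (a * b) f.
Proof.
apply: L0P.
apply: (filterS3 _ _ (scaleE a (L0_scale b f)) (scaleE b f) (scaleE (a * b) f)).
by move=> x e1 e2 e3 _; rewrite e1//= e2//= e3//= mulrA.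
Qed.

Let scale1 : left_id 1 L0_scale.
Proof.
move=> f; apply: L0P; apply: filterS (scaleE 1 f).
by move=> x e1 _; rewrite e1//= mul1r.
Qed.

Let scaleDr : right_distributive L0_scale +%R.
Proof.
move=> a f g; apply: L0P.
apply: (filterS5 _ _ (scaleE a (L0_add f g)) (addE f g) (addE (L0_scale a f) (L0_scale a g)) (scaleE a f) (scaleE a g)).
by move=> x e1 e2 e3 e4 e5 _; rewrite e1//= e2//= e3//= e4//= e5//= mulrDr.
Qed.

Let scaleDl f : {morph L0_scale ^~ f : a b / a + b}.
Proof.
move=> a b; apply: L0P.
apply: (filterS4 _ _ (scaleE (a + b) f) (addE (L0_scale a f) (L0_scale b f)) (scaleE a f) (scaleE b f)).
by move=> x e1 e2 e3 e4 _; rewrite e1//= e2//= e3//= e4//= mulrDl.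
Qed.

HB.instance Definition _ :=
  GRing.Zmodule_isLmodule.Build R L0 scaleA scale1 scaleDr scaleDl.

Lemma L0_0 : ((0 : L0) : T -> R) = cst 0 %[ae mu].
Proof. exact: L0_ofE. Qed.

Lemma L0_D f g : ((f + g : L0) : T -> R) = (f : T -> R) \+ g %[ae mu].
Proof. exact: L0_ofE. Qed.

Lemma L0_N f : ((- f : L0) : T -> R) = \- (f : T -> R) %[ae mu].
Proof. exact: L0_ofE. Qed.

Lemma L0_M f g : ((f * g : L0) : T -> R) = (f : T -> R) \* g %[ae mu].
Proof. exact: L0_ofE. Qed.

Lemma L0_Z a f : ((a *: f : L0) : T -> R) = (fun x => a * (f x : R)) %[ae mu].
Proof. exact: L0_ofE. Qed.
End L0.

Definition finL0 d (T : measurableType d) (R : realType)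
    (mu : {measure set T -> \bar R}) (p : \bar R) :
    {pred @aeEqMfun _ _ R T (measurableTypeR R) mu} :=
  mem [set f : @aeEqMfun _ _ R T (measurableTypeR R) mu |
    finite_norm mu p (f : T -> R)].
Arguments finL0 {d T R} mu p.

Section Lspace_sub.
Context d (T : measurableType d) (R : realType) (mu : {measure set T -> \bar R}).
Variables (p : \bar R) (p1 : (1 <= p)%E).

Local Notation L0 := (@aeEqMfun _ _ R T (measurableTypeR R) mu).
Local Notation Lp := (LspaceType mu p1).

Lemma Lnorm_ae_eq (f g : T -> R) : measurable_fun setT f -> measurable_fun setT g ->
  f = g %[ae mu] ->
  ('N[mu]_p[EFin \o f] = 'N[mu]_p[EFin \o g])%E.
Proof.
move=> mf mg fg; rewrite unlock /Lnorm; case: p p1 => [r r1|_|//].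
- congr (_ `^ _)%E; apply: ae_eq_integral => //.
  + apply/measurable_EFinP/(@measurableT_comp _ _ _ _ _ _ (@powR R ^~ r)) => //.
    exact: measurableT_comp.
  + apply/measurable_EFinP/(@measurableT_comp _ _ _ _ _ _ (@powR R ^~ r)) => //.
    exact: measurableT_comp.
  + by apply: filterS fg => x fg _ /=; rewrite fg.
- case: ifPn => // _; apply: eq_ess_sup.
  by apply: filterS fg => x fg /=; rewrite fg.
Qed.

Section Sub.
Context (f : L0) (fP : f \in finL0 mu p).
Definition Lspace_Sub_subproof :=
  @isFinLebesgue.Build d T R mu p p1 f (set_mem fP).
#[local] HB.instance Definition _ := Lspace_Sub_subproof.
Definition Lspace_Sub : Lp := [the LspaceType mu p1 of f].
End Sub.

Lemma Lspace_rect (K : Lp -> Type) :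
  (forall f (Pf : f \in finL0 mu p), K (Lspace_Sub Pf)) -> forall u, K u.
Proof.
move=> Ksub [f [[Pf]]].
have PfL : f \in finL0 mu p by exact: mem_set.
have -> : Pf = set_mem PfL by [].
exact: Ksub.
Qed.

Lemma Lspace_valP f (Pf : f \in finL0 mu p) : Lspace_Sub Pf = f :> L0.
Proof. by []. Qed.

HB.instance Definition _ := isSub.Build _ _ Lp Lspace_rect Lspace_valP.
HB.instance Definition _ := [Choice of Lp by <:].

End Lspace_sub.

(* The normed space L^p, on the library type LspaceType. *)
Section Lspace_norm.
Context d (T : measurableType d) (R : realType) (mu : {measure set T -> \bar R}).
Variables (p : \bar R) (p1 : (1 <= p)%E).

Local Notation L0 := (@aeEqMfun _ _ R T (measurableTypeR R) mu).
Local Notation Lp := (LspaceType mu p1).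

Let finite_norm_Lfun (f : L0) : f \in finL0 mu p -> (f : T -> R) \in Lfun mu p.
Proof.
by rewrite inE => ff; apply/andP; split; rewrite inE//=; exact: L0_measurable.
Qed.

Let Lfun_finite_norm (f : L0) (g : T -> R) : (f : T -> R) = g %[ae mu] ->
  g \in Lfun mu p -> f \in finL0 mu p.
Proof.
move=> fg /andP[]; rewrite !inE/= => mg; rewrite /finite_norm => ng.
by rewrite (@Lnorm_ae_eq _ _ _ _ _ p1 _ g)//; exact: L0_measurable.
Qed.

Lemma Lspace_submod_closed : submod_closed (finL0 mu p).
Proof.
split; first exact: Lfun_finite_norm (L0_0 mu) (@LfunP _ _ _ _ _ p1 (cst 0)).
move=> a; move=> /= f g /finite_norm_Lfun fL /finite_norm_Lfun gL.
apply: (@Lfun_finite_norm _ (a *: ((f : L0) : T -> R) + ((g : L0) : T -> R))).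
  apply: (filterS2 _ _ (L0_D (a *: f) g) (L0_Z a f)) => x e1 e2 _.
  by rewrite e1//= e2.
have [_ +] := @Lfun_submod_closed _ _ _ mu p p1; exact.
Qed.

HB.instance Definition _ := GRing.isSubmodClosed.Build _ _ (finL0 mu p)
  Lspace_submod_closed.
HB.instance Definition _ := [SubChoice_isSubLmodule of Lp by <:].

Definition Lspace_norm (f : Lp) : R := fine ('N[mu]_p[EFin \o (f : T -> R)])%E.

Let Lspace_normE (f : Lp) :
  (Lspace_norm f)%:E = ('N[mu]_p[EFin \o (f : T -> R)])%E.
Proof.
rewrite /Lspace_norm fineK// fin_numElt (lt_le_trans ltNy0) ?Lnorm_ge0//=.
exact: Lebesgue_finite.
Qed.

Let Lspace_normD (f g : Lp) : Lspace_norm (f + g) <= Lspace_norm f + Lspace_norm g.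
Proof.
rewrite -lee_fin EFinD !Lspace_normE.
rewrite (@Lnorm_ae_eq _ _ _ _ _ p1 _ ((f : T -> R) \+ (g : T -> R)));
  [|exact: L0_measurable|by apply: measurable_funD; exact: L0_measurable|exact: L0_D].
by apply: eminkowski => //; exact: L0_measurable.
Qed.

Let Lspace_normZ a (f : Lp) : Lspace_norm (a *: f) = `|a| * Lspace_norm f.
Proof.
have fL : (f : T -> R) \in Lfun mu p by apply: finite_norm_Lfun; exact: valP.
apply: EFin_inj; rewrite EFinM !Lspace_normE.
rewrite (@Lnorm_ae_eq _ _ _ _ _ p1 _ (a \*: (f : T -> R)));
  [|exact: L0_measurable|by apply: measurable_funM => //; exact: L0_measurable|exact: L0_Z].
exact: (LnormZ (Lfun_Sub p1 fL)).
Qed.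

Let Lspace_norm0_eq0 (f : Lp) : Lspace_norm f = 0 -> f = 0.
Proof.
have fL : (f : T -> R) \in Lfun mu p by apply: finite_norm_Lfun; exact: valP.
move=> f0; apply: val_inj; rewrite raddf0; apply: L0P.
have h1 := @fine_Lnormr_eq0 _ _ _ _ _ _ (Lfun_Sub p1 fL) f0.
have h2 := L0_0 mu.
rewrite /=; apply: (filterS2 _ _ h1 h2) => x e1 e2 _.
by rewrite [LHS]e1//= e2.
Qed.

HB.instance Definition _ := @Lmodule_isNormed.Build R Lp Lspace_norm
  Lspace_normD Lspace_normZ Lspace_norm0_eq0.

End Lspace_norm.

(* The topological dual with the operator norm. *)
Section dual_space.
Context {R : realType} (U : normedModType R).

Definition dual_pred : {pred U -> R^o} :=
  mem [set f : U -> R^o | linear f /\ continuous f].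

Record dual_space := Dual { dual_fun :> U -> R^o ; _ : dual_fun \in dual_pred }.

HB.instance Definition _ := [isSub for dual_fun].
HB.instance Definition _ := [Choice of dual_space by <:].

Lemma dual_submod_closed : submod_closed dual_pred.
Proof.
split.
  rewrite inE; split; last exact: cst_continuous.
  by move=> a u v; rewrite scaler0 addr0.
move=> a f g; rewrite !inE => -[lf cf] [lg cg]; split.
  move=> b u v; rewrite -[LHS]/(a *: f (b *: u + v) + g (b *: u + v)) lf lg.
  rewrite -[RHS]/(b *: (a *: f u + g u) + (a *: f v + g v)).
  by rewrite !scalerDr !scalerA [b * a]mulrC addrACA.
move=> x; apply: (@cvgD _ _ _ _ _ (fun u => a *: f u) g); last exact: cg.
by apply: cvgZr; exact: cf.
Qed.

HB.instance Definition _ := GRing.isSubmodClosed.Build _ _ dual_pred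
  dual_submod_closed.
HB.instance Definition _ := [SubChoice_isSubLmodule of dual_space by <:].

Lemma dual_linear (f : dual_space) : linear f.
Proof. by have := valP f; rewrite inE => -[]. Qed.

Lemma dual_continuous (f : dual_space) : continuous f.
Proof. by have := valP f; rewrite inE => -[]. Qed.

HB.instance Definition _ (f : dual_space) :=
  GRing.isLinear.Build R U R^o _ (f : U -> R^o) (dual_linear f).

Definition dual_norm (f : dual_space) : R :=
  sup [set `|f u| | u in [set u : U | `|u| <= 1]].

Let dual_has_sup (f : dual_space) :
  has_sup [set `|f u| | u in [set u : U | `|u| <= 1]].
Proof.
split; first by exists `|f 0|, 0 => //=; rewrite normr0.
have /linear_bounded_continuous/bounded_funP/(_ 1)[M fM] := @dual_continuous f.
by exists M => _ [u u1 <-]; exact: fM.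
Qed.

Let dual_norm_ge (f : dual_space) u : `|u| <= 1 -> `|f u| <= dual_norm f.
Proof. by move=> u1; apply: sup_upper_bound => //; exists u. Qed.

Let dual_norm_le (f : dual_space) M :
  (forall u, `|u| <= 1 -> `|f u| <= M) -> dual_norm f <= M.
Proof.
move=> fM; apply: ge_sup; first by case: (dual_has_sup f).
by move=> _ [u u1 <-]; exact: fM.
Qed.

Let dual_normD (f g : dual_space) : dual_norm (f + g) <= dual_norm f + dual_norm g.
Proof.
apply: dual_norm_le => u u1; rewrite (le_trans (ler_normD _ _))//.
by rewrite lerD// dual_norm_ge.
Qed.

Let dual_normZ_le a (f : dual_space) : dual_norm (a *: f) <= `|a| * dual_norm f.
Proof.
apply: dual_norm_le => u u1; rewrite [leLHS]normrZ.
by rewrite ler_wpM2l// dual_norm_ge.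
Qed.

Let dual_normZ a (f : dual_space) : dual_norm (a *: f) = `|a| * dual_norm f.
Proof.
have [->|a0] := eqVneq a 0.
  rewrite scale0r normr0 mul0r; apply/eqP; rewrite eq_le; apply/andP; split.
    by apply: dual_norm_le => u _; rewrite normr0.
  by rewrite (le_trans (normr_ge0 _) (@dual_norm_ge 0 0 _))// normr0.
apply/eqP; rewrite eq_le dual_normZ_le/=.
rewrite -ler_pdivlMl ?normr_gt0// -normfV.
by rewrite (le_trans _ (dual_normZ_le _ _))// scalerA mulVf// scale1r.
Qed.

Let dual_norm_eq0 (f : dual_space) : dual_norm f = 0 -> f = 0.
Proof.
move=> f0; apply/val_inj/funext => u /=.
have [->|u0] := eqVneq u 0; first by rewrite linear0.
have := @dual_norm_ge f (`|u|^-1 *: u); rewrite f0 normrZ normfV normr_id.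
rewrite mulVf ?normr_eq0// => /(_ (lexx _)).
rewrite linearZ/= normr_le0 => /eqP.
by move/eqP; rewrite scaler_eq0 invr_eq0 normr_eq0 (negbTE u0) => /eqP.
Qed.

HB.instance Definition _ := @Lmodule_isNormed.Build R dual_space dual_norm
  dual_normD dual_normZ dual_norm_eq0.

End dual_space.

Definition reflexive_space {R : realType} (U : normedModType R) :=
  forall Phi : dual_space (dual_space U), exists u : U, forall phi : dual_space U, Phi phi = phi u.

Section euclidean.
Context {R : realType} (d : nat).
Implicit Types x y : 'rV[R]_d.

Definition edot x y : R := \sum_i x ord0 i * y ord0 i.

(* The library norm on 'rV[R]_d is the maximum norm. *)
Definition enorm x : R := Num.sqrt (edot x x).

Definition ediameter (A : set 'rV[R]_d) : R :=
  sup [set r | exists x y, [/\ A x, A y & r = enorm (x - y)]].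

End euclidean.

(* Near every boundary point the domain is, in suitable Cartesian coordinates
   with last axis e, the strict epigraph of a Lipschitz function phi.  The point
   y - (y . e) e is the projection of y on the hyperplane orthogonal to e; a
   Lipschitz function on that hyperplane is the restriction of one on R^d. *)
Record lipschitz_domain (R : realType) (d : nat) := LipschitzDomain {
  domain_set :> set 'rV[R]_d ;
  domain_dim_gt0 : (0 < d)%N ;
  domain_open : open domain_set ;
  domain_connected : connected domain_set ;
  domain_nonempty : domain_set !=set0 ;
  domain_bounded : bounded_set domain_set ;
  domain_boundary : forall x, (closure domain_set `\` domain_set) x ->
    exists (e : 'rV[R]_d) (phi : 'rV[R]_d -> R^o),
      [/\ enorm e = 1, lipschitz phi &
          \forall y \near x,
            domain_set y <-> phi (y - edot y e *: e) < edot y e] }.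

Section domain_measure.
Context {R : realType} {d : nat} (Omega : lipschitz_domain R d).

Lemma measurable_domain : measurable (Omega : set 'rV[R]_d).
Proof. by apply: open_measurable_rV; exact: domain_open. Qed.

Definition domain_measure : {measure set 'rV[R]_d -> \bar R} :=
  mrestr (lebesgue_measure_rV d) measurable_domain.

End domain_measure.

(* Functions on Omega are encoded as functions on R^d modulo equality almost
   everywhere in Omega. *)
Notation L0 R Omega :=
  (@aeEqMfun _ _ R _ (measurableTypeR R) (domain_measure Omega)).
Notation Lp Omega p1 := (LspaceType (domain_measure Omega) p1).
Notation L2 Omega := (LspaceType2 (domain_measure Omega)).
Notation Loo Omega := (LspaceType (domain_measure Omega) (leey 1%E)).

Record mesh (R : realType) (d : nat) (Omega : lipschitz_domain R d) (N : nat) :=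
  Mesh {
    cell :> 'I_N -> set 'rV[R]_d ;
    measurable_cell : forall i, measurable (cell i) ;
    mesh_partition : partition [set: 'I_N] cell (Omega : set 'rV[R]_d) ;
    cell_measure_gt0 : forall i, (0 < domain_measure Omega (cell i))%E }.

Section mesh.
Context {R : realType} {d : nat} {Omega : lipschitz_domain R d} {N : nat}.
Variable Q : mesh Omega N.
Implicit Types (v z : L0 R Omega) (i : 'I_N).

Local Notation mu := (domain_measure Omega).

Definition mesh_size : R := \big[Num.max/0]_(i < N) ediameter (Q i).

Definition cell_average v i : R :=
  (fine (mu (Q i)))^-1 * \int[mu]_(x in Q i) (v x : R).

Definition cell_indicator i : L0 R Omega :=
  L0_of mu (@measurable_indic _ 'rV[R]_d R setT (Q i) (measurable_cell Q i)).

Definition local_average v : L0 R Omega :=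
  \sum_(i < N) cell_average v i *: cell_indicator i.

Definition cell_constant i z (c : R) := \forall x \ae mu, Q i x -> z x = c.

Definition piecewise_constant z := forall i, exists c, cell_constant i z c.

Definition cell_value i z : R := xget 0 [set c | cell_constant i z c].

End mesh.

Section convex_problems.
Context {R : realType} {E : lmodType R}.

Definition convex_hull (A : set E) : set E :=
  smallest (@convex_set R E) A.

Definition convex_minimization_problem (D : set E) (J : E -> R) :=
  convex_set D /\ convex_function D J.

Definition is_minimizer (D : set E) (J : E -> R) (x : E) :=
  D x /\ forall y, D y -> J x <= J y.

End convex_problems.

Definition finite_dimensional_ansatz {R : realType} {E : lmodType R}
    (V : set E) :=
  exists (n : nat) (b : 'I_n -> E),
    forall v, V v -> exists c : 'I_n -> R, v = \sum_(i < n) c i *: b i.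

(* P maps every point to a nearest point of S; for nonconvex S the nearest
   point need not be unique. *)
Definition metric_projection {R : realType} {E : normedModType R} (S : set E)
    (P : E -> E) :=
  forall x, S (P x) /\ forall y, S y -> `|x - P x| <= `|x - y|.

Definition isomorphism {R : realType} {V W : normedModType R} (f : V -> W) :=
  [/\ linear f, continuous f &
      exists g : W -> V, [/\ cancel f g, cancel g f & continuous g]].

Section problems.
Context {R : realType} {d : nat} {Omega : lipschitz_domain R d}.
Context {U Y : normedModType R}.
Variable emb : U -> L0 R Omega.

Local Notation mu := (domain_measure Omega).

(* phi is the functional v |-> \int_Omega g v dx on U *)
Definition represents (g : L0 R Omega) (phi : dual_space U) :=
  forall v : U,
    mu.-integrable setT (fun x => ((g x : R) * (emb v x : R))%:E) /\
    phi v = \int[mu]_x ((g x : R) * (emb v x : R)).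

(* A u + f0 g = f1 in the dual of U *)
Definition state_equation (A : U -> dual_space U) (f0 : L0 R Omega)
    (f1 : dual_space U) (u : U) (g : L0 R Omega) :=
  exists2 phi : dual_space U, represents (f0 * g) phi & A u + phi = f1.

Context {N : nat}.
Variable Q : mesh Omega N.

Local Notation P_ v := (local_average Q v).

Definition mcc (ul uu wl wu : 'I_N -> R) (i : 'I_N) (u w z : L0 R Omega) :=
  let zi := cell_value Q i z in
  \forall x \ae mu, Q i x ->
    [/\ ul i * P_ w x + wl i * P_ u x - ul i * wl i - zi <= 0,
        uu i * P_ w x + wu i * P_ u x - uu i * wu i - zi <= 0,
        zi - uu i * P_ w x - wl i * P_ u x + uu i * wl i <= 0 &
        zi - ul i * P_ w x - wu i * P_ u x + ul i * wu i <= 0].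

Definition tracking_objective (T : L2 Omega -> Y) (emb2 : U -> L2 Omega)
    (ydelta : Y) (u : U) : R := `|T (emb2 u) - ydelta|.

Definition I_feasible (A : U -> dual_space U) (f0 : L0 R Omega)
    (f1 : dual_space U) (Wh : set (L0 R Omega)) : set (U * L0 R Omega) :=
  [set uw | state_equation A f0 f1 uw.1 (P_ (emb uw.1) * P_ uw.2) /\ Wh uw.2].

Definition McC_feasible (A : U -> dual_space U) (f0 : L0 R Omega)
    (f1 : dual_space U) (ul uu wl wu : 'I_N -> R)
    (Wh Z : set (L0 R Omega)) : set (U * L0 R Omega * L0 R Omega) :=
  [set uwz | let: (u, w, z) := uwz in
    [/\ state_equation A f0 f1 u z,
        forall i, mcc ul uu wl wu i (emb u) w z,
        convex_hull Wh w & Z z]].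

End problems.

(* Main.v *)
(* The reduced problem is finite-dimensional.  Since W_h^ad and Z_tau^ad are closed
   (the former because a metric projection onto it exists), bounded, and contained
   in the span of finitely many functions, they are linear images of compact sets
   of coordinates; by Caratheodory's theorem the convex hull of W_h^ad is one too.
   By Hoelder's inequality f0 z is a functional on U that depends linearly on the
   coordinates e of z, so the state equation forces u = A^-1 (f1 - Phi e), which is
   affine in e.  The McCormick inequalities only involve cell averages, which are
   affine in the coordinates, so the feasible set is the image of a compact set of
   coordinates, on which the objective is continuous. *)
Require Import Defs.
From HB Require Import structures.
From mathcomp Require Import all_boot all_order all_algebra.
From mathcomp Require Import all_classical all_reals all_analysis.
From mathcomp Require Import measurable_realfun ess_sup_inf ring lra.
Set Implicit Arguments.
Unset Strict Implicit.
Unset Printing Implicit Defensive.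
Import Order.TTheory GRing.Theory Num.Theory.
Import numFieldNormedType.Exports.
Local Open Scope classical_set_scope.
Local Open Scope ring_scope.

(** * Convex hulls *)

Section convexity.
Context {R : realType}.

Lemma convex_setP (E : lmodType R) (A : set E) : convex_set A <->
  forall (t : R) x y, 0 <= t -> t <= 1 -> A x -> A y -> A (t *: x + (1 - t) *: y).
Proof.
split=> [cA t x y t0 t1 Ax Ay | cA x y t].
  have := cA x y (Itv01 t0 t1); rewrite !in_setE; exact.
by rewrite !in_setE => Ax Ay; apply: cA => //; exact: le1.
Qed.

Lemma convex_hull_convex (E : lmodType R) (A : set E) : convex_set (convex_hull A).
Proof.
apply/convex_setP => t x y t0 t1 Ax Ay B [cB AB].
by move/convex_setP: (cB); apply => //; [exact: Ax|exact: Ay].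
Qed.

Lemma sub_convex_hull (E : lmodType R) (A : set E) : A `<=` convex_hull A.
Proof. exact: sub_gen_smallest. Qed.

Lemma convex_hull_sub (E : lmodType R) (A B : set E) :
  convex_set B -> A `<=` B -> convex_hull A `<=` B.
Proof. exact: smallest_sub. Qed.

Lemma linear_combination2 (E F : lmodType R) (f : E -> F) (a b : R) x y :
  linear f -> f (a *: x + b *: y) = a *: f x + b *: f y.
Proof.
move=> lf; have f0 : f 0 = 0.
  by have := lf (-1) 0 0; rewrite !scaleN1r oppr0 addr0 addNr.
by rewrite lf -[b *: y]addr0 lf f0 addr0.
Qed.

(** Images and preimages of convex sets under a linear map are convex, so each inclusion follows
    from the minimality of a hull. The lemma moves the hull of the admissible controls into
    coordinates. *)
Lemma convex_hull_image (E F : lmodType R) (f : E -> F) (A : set E) :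
  linear f -> convex_hull (f @` A) = f @` convex_hull A.
Proof.
move=> lf; apply/seteqP; split.
  apply: convex_hull_sub; last by apply: image_subset; exact: sub_convex_hull.
  apply/convex_setP => t _ _ t0 t1 [x Ax <-] [y Ay <-].
  exists (t *: x + (1 - t) *: y); last exact: linear_combination2.
  by move/convex_setP: (@convex_hull_convex _ A); exact.
apply: (@subset_trans _ (f @` (f @^-1` convex_hull (f @` A)))); last first.
  exact: image_preimage_subset.
apply: image_subset; apply: convex_hull_sub; last first.
  by move=> x Ax; apply: (@sub_convex_hull _ (f @` A)); exists x.
apply/convex_setP => t x y t0 t1 Ax Ay /=; rewrite linear_combination2//.
by move/convex_setP: (@convex_hull_convex _ (f @` A)); exact.
Qed.

(** The number [k] of points is a parameter because Caratheodory's theorem reduces it. Points may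
    repeat and weights may vanish. *)
Definition convex_combination (E : lmodType R) (A : set E) k (v : E) :=
  exists (t : 'I_k -> R) (x : 'I_k -> E),
    [/\ forall i, 0 <= t i, \sum_i t i = 1, forall i, A (x i) &
        v = \sum_i t i *: x i].

(** Induction on the number of points: all but the first are merged into one point by dividing their
    weights by the remaining mass [1 - t ord0]. *)
Lemma convex_combination_hull (E : lmodType R) (A : set E) k v :
  convex_combination A k v -> convex_hull A v.
Proof.
elim: k v => [|k ih] v [t [x [t0 t1 Ax ->]]].
  by move: t1; rewrite big_ord0 => /esym/eqP; rewrite oner_eq0.
move: t1; rewrite !big_ord_recl/= => /(canRL (addKr _)); rewrite addrC => t1.
(* If the first weight is 1, the others vanish and cannot be renormalised. *)
have [t01|t01] := eqVneq (t ord0) 1.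
  rewrite big1 ?addr0 ?t01 ?scale1r; first exact: (sub_convex_hull (Ax ord0)).
  move=> i _; move/eqP: t1; rewrite t01 subrr psumr_eq0// => /allP/(_ i).
  by rewrite mem_index_enum => /(_ isT) /eqP ->; rewrite scale0r.
have s0 : 0 <= 1 - t ord0 by rewrite -t1 sumr_ge0.
have s1 : 1 - t ord0 != 0 by rewrite subr_eq0 eq_sym.
have := @convex_hull_convex _ A; move/convex_setP.
move=> /(_ (t ord0) (x ord0) (\sum_i (t (lift ord0 i) / (1 - t ord0)) *: x (lift ord0 i))).
rewrite scaler_sumr.
under [X in convex_hull A (_ + X)]eq_bigr do rewrite scalerA mulrC divfK//.
apply => //; [by rewrite -subr_ge0|exact: (sub_convex_hull (Ax ord0))|].
apply: ih; exists (fun i => t (lift ord0 i) / (1 - t ord0)), (x \o lift ord0); split => //.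
- by move=> i; rewrite divr_ge0.
- by rewrite -mulr_suml t1 divff.
- by move=> i; exact: Ax.
Qed.

(** The two families are concatenated, with weights scaled by [s] and [1 - s]. *)
Lemma convex_combination_mix (E : lmodType R) (A : set E) k l (s : R) u v :
  0 <= s -> s <= 1 -> convex_combination A k u -> convex_combination A l v ->
  convex_combination A (k + l) (s *: u + (1 - s) *: v).
Proof.
move=> s0 s1 [t [x [t0 t1 Ax ->]]] [t' [x' [t'0 t'1 Ax' ->]]].
exists (fun i => match fintype.split i with inl j => s * t j | inr j => (1 - s) * t' j end).
exists (fun i => match fintype.split i with inl j => x j | inr j => x' j end).
split.
- by move=> i; case: splitP => j _; rewrite mulr_ge0 ?subr_ge0.
- rewrite big_split_ord/=.
  under eq_bigr do rewrite -[lshift _ _]/(unsplit (inl _)) unsplitK.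
  under [X in _ + X]eq_bigr do rewrite -[rshift _ _]/(unsplit (inr _)) unsplitK.
  by rewrite -!mulr_sumr t1 t'1 !mulr1 addrC subrK.
- by move=> i; case: splitP => j _.
- rewrite big_split_ord/=.
  under [in RHS]eq_bigr do rewrite -[lshift _ _]/(unsplit (inl _)) unsplitK -scalerA.
  under [X in _ = _ + X]eq_bigr do
    rewrite -[rshift _ _]/(unsplit (inr _)) unsplitK -scalerA.
  by rewrite !scaler_sumr.
Qed.

Lemma convex_combination_drop (E : lmodType R) (A : set E) k t x :
  (forall i : 'I_k.+1, 0 <= t i) -> \sum_i t i = 1 -> (forall i, A (x i)) ->
  (exists j, t j = 0) ->
  convex_combination A k (\sum_i t i *: x i).
Proof.
move=> t0 t1 Ax [j tj0]; exists (t \o lift j), (x \o lift j); split => //=.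
- by rewrite -t1 (bigD1_ord j)//= tj0 add0r.
- by rewrite (bigD1_ord j)//= tj0 scale0r add0r.
Qed.

(* An affine dependence among more than n + 1 points allows to shift weight along
   it until one of the coefficients vanishes. *)
Lemma caratheodory_step n (A : set 'rV[R]_n) k v : (n < k)%N ->
  convex_combination A k.+1 v -> convex_combination A k v.
Proof.
move=> nk [t [x [t0 t1 Ax ->]]].
(* Row [i] is the point [x i] preceded by a 1, so a row vector in the kernel is an affine
   dependence. There are k + 1 rows, while the rank is at most n + 1 <= k. *)
pose M : 'M[R]_(k.+1, 1 + n) := \matrix_i row_mx 1 (x i).
have : kermx M != 0.
  by rewrite kermx_eq0 /row_free ltn_eqF// (leq_ltn_trans (rank_leq_col _)).
case/rowV0Pn => c /sub_kermxP cM c0.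
have [c1 cx] : (\sum_i c 0 i = 0) /\ (\sum_i c 0 i *: x i = 0).
  have : \sum_i c 0 i *: row_mx (1 : 'M[R]_1) (x i) = 0.
    apply: etrans cM; rewrite mulmx_sum_row; apply: eq_bigr => i _; by rewrite rowK.
  under eq_bigr do rewrite scale_row_mx.
  move=> /(congr1 (fun X => (lsubmx X, rsubmx X))).
  rewrite !linear_sum/= !linear0 => -[h1 h2]; split; last first.
    by apply: etrans h2; apply: eq_bigr => i _; rewrite row_mxKr.
  move/(congr1 (fun X : 'M[R]_1 => X 0 0)): h1; rewrite summxE mxE => h1.
  by apply: etrans h1; apply: eq_bigr => i _; rewrite row_mxKl !mxE mulr1.
(* The entries of the nonzero [c] sum to zero, so one of them is positive. *)
have [i0 ci0] : exists i, 0 < c 0 i.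
  apply/existsP; apply: contraT; rewrite negb_exists => /forallP cle0.
  have h i : 0 <= - c 0 i by rewrite oppr_ge0 leNgt.
  case/negP: c0; apply/eqP/rowP => i; rewrite mxE; apply/eqP; rewrite -oppr_eq0.
  have : \sum_i - c 0 i == 0 by rewrite sumrN c1 oppr0.
  by rewrite psumr_eq0// => /allP/(_ i); rewrite mem_index_enum => /(_ isT).
(* The smallest ratio over the positive entries of [c] is the largest shift that keeps all weights
   nonnegative; at its index the weight becomes zero. *)
case: (@arg_minP _ _ _ i0 (fun i => 0 < c 0 i) (fun i => t i / c 0 i) ci0) => i ci imin.
pose s := t i / c 0 i.
have s0 : 0 <= s by rewrite divr_ge0// ltW.
have -> : \sum_i t i *: x i = \sum_i (t i - s * c 0 i) *: x i.
  under [RHS]eq_bigr do rewrite scalerBl -scalerA.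
  by rewrite sumrB -scaler_sumr cx scaler0 subr0.
apply: convex_combination_drop => //.
- move=> j; rewrite subr_ge0; have [cj|cj] := ltP 0 (c 0 j).
    by rewrite -ler_pdivlMr//; exact: imin.
  by rewrite (le_trans _ (t0 j))// mulr_ge0_le0.
- by rewrite sumrB -mulr_sumr c1 mulr0 subr0.
- by exists i; rewrite /s divfK ?subrr// gt_eqF.
Qed.

(** Combinations of n + 1 points form a convex set: mixing two of them gives 2n + 2 points, which
    [caratheodory_step] reduces to n + 1 again. *)
Lemma caratheodory n (A : set 'rV[R]_n) : convex_hull A = convex_combination A n.+1.
Proof.
have red k v : convex_combination A (n.+1 + k) v -> convex_combination A n.+1 v.
  elim: k => [|k ih]; first by rewrite addn0.
  by rewrite addnS => /caratheodory_step => h; apply/ih/h; rewrite addSn ltnS leq_addr.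
apply/seteqP; split=> [|v]; last exact: convex_combination_hull.
apply: convex_hull_sub.
  apply/convex_setP => s u v s0 s1 uA vA.
  exact/red/(convex_combination_mix s0 s1 uA vA).
(* A single point is repeated n + 1 times, with all the weight on the first copy. *)
move=> v Av; exists (fun i => (i == ord0)%:R), (fun=> v); split => //.
- by rewrite (bigD1 ord0)//= big1 ?addr0// => i /negbTE ->.
- by rewrite -scaler_suml (bigD1 ord0)//= big1 ?addr0 ?scale1r// => i /negbTE ->.
Qed.

End convexity.

(** * Finite-dimensional sets *)

Section finite_dimension.
Context {R : realType}.

Lemma bounded_setP (V : normedModType R) (A : set V) :
  bounded_set A <-> exists M, forall x, A x -> `|x| <= M.
Proof.
split=> [[M [_ AM]]|[M AM]].
  by exists (M + 1) => x; apply: AM; rewrite ltrDl.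
by exists M; split; [exact: num_real|move=> N MN x /AM /le_trans; apply; exact: ltW].
Qed.

Lemma linear_continuous_of_bound (V W : normedModType R) (f : V -> W) C :
  linear f -> (forall v, `|f v| <= C * `|v|) -> continuous f.
Proof.
move=> lf fC; pose g : {linear V -> W} := HB.pack f (GRing.isLinear.Build R V W _ f lf).
apply: (@bounded_linear_continuous _ _ _ g); apply/linear_boundedP.
exists C; split; [exact: num_real|move=> r Cr x].
by rewrite (le_trans (fC x))// ler_wpM2r// ltW.
Qed.

Lemma linear_continuous_bound (V W : normedModType R) (f : V -> W) :
  linear f -> continuous f -> exists2 C, 0 <= C & forall v, `|f v| <= C * `|v|.
Proof.
move=> lf cf; pose g : {linear V -> W} := HB.pack f (GRing.isLinear.Build R V W _ f lf).
have /linear_bounded_continuous/linear_boundedP[M [_ Mf]] : continuous g by [].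
exists (`|M| + 1) => [|v]; first by rewrite addr_ge0.
by apply: (Mf (`|M| + 1)); rewrite (le_lt_trans (ler_norm M))// ltrDl.
Qed.

Lemma linear_sumZ (V W : lmodType R) (f : V -> W) n (c : 'I_n -> R) (x : 'I_n -> V) :
  linear f -> f (\sum_i c i *: x i) = \sum_i c i *: f (x i).
Proof.
move=> lf; pose g : {linear V -> W} := HB.pack f (GRing.isLinear.Build R V W _ f lf).
by rewrite -[f]/(g : V -> W) linear_sum; apply: eq_bigr => i _; rewrite linearZ.
Qed.

(** Entries may lie in any topological space, because [convex_hull_compact] uses row vectors whose
    entries are themselves points. *)
Lemma coordmx_continuous (T : topologicalType) m n i j :
  continuous (fun M : 'M[T]_(m, n) => M i j).
Proof.
move=> M P MP; exists (fun i' j' => if (i', j') == (i, j) then P else setT).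
  by move=> i' j'; case: eqP => [[-> ->]|_] //; exact: filterT.
by move=> N /(_ i j); rewrite eqxx.
Qed.

Lemma continuous_sumr (T : topologicalType) (V : normedModType R) n
    (f : 'I_n -> T -> V) :
  (forall i, continuous (f i)) -> continuous (fun x => \sum_i f i x).
Proof.
by move=> cf; apply: continuous_big => //; exact: add_continuous.
Qed.

Lemma linear_rV_continuous n (V : normedModType R) (f : 'rV[R]_n -> V) :
  linear f -> continuous f.
Proof.
move=> lf; rewrite (_ : f = fun c => \sum_i c 0 i *: f 'e_i).
  apply: continuous_sumr => i c; apply: (@cvgZ _ _ _ (nbhs c)).
    exact: coord_continuous.
  exact: cvg_cst.
by apply/funext => c; rewrite -linear_sumZ// -row_sum_delta.
Qed.

Definition lin_comb (V : lmodType R) n (b : 'I_n -> V) (c : 'rV[R]_n) : V :=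
  \sum_i c 0 i *: b i.

Lemma lin_comb_linear (V : lmodType R) n (b : 'I_n -> V) : linear (lin_comb b).
Proof.
move=> a c c'; rewrite /lin_comb scaler_sumr -big_split/=.
by apply: eq_bigr => i _; rewrite !mxE scalerDl scalerA.
Qed.

(** Caratheodory's theorem bounds the number of points, so the hull is a continuous image of the
    product of a simplex with n + 1 copies of [A], which is compact. *)
Lemma convex_hull_compact n (A : set 'rV[R]_n) :
  compact A -> compact (convex_hull A).
Proof.
move=> cA; rewrite caratheodory.
pose D : set ('rV[R]_n.+1 * 'rV['rV[R]_n]_n.+1) :=
  ([set t : 'rV[R]_n.+1 | forall i, `[0, 1]%classic (t ord0 i)] `&`
   [set t | \sum_i t ord0 i = 1]) `*`
  [set x : 'rV['rV[R]_n]_n.+1 | forall i, A (x ord0 i)].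
have -> : convex_combination A n.+1 =
    (fun tx => \sum_i tx.1 ord0 i *: tx.2 ord0 i) @` D.
  apply/seteqP; split=> [v [t [x [t0 t1 Ax ->]]]|_ [[t x] [[/= tI t1] Ax] <-]].
    exists (\row_i t i, \row_i x i) => /=; last by apply: eq_bigr => i _; rewrite !mxE.
    split; last by move=> i /=; rewrite mxE.
    split => /= [i|]; last by rewrite -[RHS]t1; apply: eq_bigr => i _; rewrite mxE.
    by rewrite mxE in_itv/= t0/= -t1 (bigD1 i)//= lerDl sumr_ge0.
  exists (t ord0), (x ord0); split => // i.
  by have := tI i; rewrite /= in_itv/= => /andP[].
apply: continuous_compact.
  apply: continuous_subspaceT; apply: continuous_sumr => i tx.
  apply: (@cvgZ _ _ _ (nbhs tx)); last first.
    apply: (@continuous_comp _ _ _ snd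
      (fun x : 'rV['rV[R]_n]_n.+1 => x ord0 i)); first exact: cvg_snd.
    exact: coordmx_continuous.
  apply: (@continuous_comp _ _ _ fst (fun t : 'rV[R]_n.+1 => t ord0 i)).
    exact: cvg_fst.
  exact: coord_continuous.
apply: compact_setX; last exact: (@rV_compact _ _ (fun=> A)).
apply: compact_closedI; first apply: (@rV_compact R n.+1 (fun=> `[0, 1]%classic)) => i.
  exact: segment_compact.
apply: (@closed_comp _ _ (fun t : 'rV[R]_n.+1 => \sum_i t ord0 i) [set x | x = 1]).
  by move=> t _; apply: continuous_sumr => i; exact: coord_continuous.
exact: closed_eq.
Qed.

(** On the compact unit sphere the norm of the combination attains its minimum, which is positive by
    independence; scaling extends the bound to all coordinates. *)
Lemma independent_lower_bound (V : normedModType R) n (b : 'I_n -> V) :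
  (forall c, lin_comb b c = 0 -> c = 0) ->
  exists C, forall c, `|c| <= C * `|lin_comb b c|.
Proof.
move=> inj; pose S : set 'rV[R]_n := [set c | `|c| = 1].
have cS : compact S.
  apply: bounded_closed_compact.
    by apply/bounded_setP; exists 1 => x ->.
  apply: (@closed_comp _ _ (fun c : 'rV[R]_n => `|c|) [set x | x = 1]).
    by move=> t _; exact: norm_continuous.
  exact: closed_eq.
have SE c : c != 0 -> S (`|c|^-1 *: c).
  by move=> c0; rewrite /S/= normrZ normfV normr_id mulVf// normr_eq0.
(* If the sphere is empty, as for n = 0, every coordinate vector is zero and the constant 0
   works. *)
have [[c0 Sc0]|S0] := pselect (S !=set0); last first.
  exists 0 => c; have [->|/SE Sc] := eqVneq c 0; first by rewrite normr0 mul0r.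
  by exfalso; apply: S0; eexists; exact: Sc.
have cf : {within S, continuous (fun c => `|lin_comb b c|)}.
  apply: continuous_subspaceT => c; apply: continuous_comp; last exact: norm_continuous.
  by apply: linear_rV_continuous; exact: lin_comb_linear.
have [c1 /set_mem Sc1 c1min] := compact_EVT_min (ex_intro _ c0 Sc0) cS cf.
have m0 : 0 < `|lin_comb b c1|.
  rewrite normr_gt0; apply/eqP => /inj c10; move: Sc1.
  by rewrite /S/= c10 normr0 => /esym/eqP; rewrite oner_eq0.
exists `|lin_comb b c1|^-1 => c.
have [->|cn0] := eqVneq c 0; first by rewrite normr0 mulr_ge0// invr_ge0.
rewrite ler_pdivlMl// -ler_pdivlMr ?normr_gt0//.
have := c1min (`|c|^-1 *: c); rewrite inE => /(_ (SE _ cn0)) /le_trans; apply.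
have := lin_comb_linear b `|c|^-1 c 0; rewrite addr0 => ->.
rewrite /lin_comb [X in _ + X]big1 => [|i _]; last by rewrite mxE scale0r.
by rewrite addr0 normrZ normfV normr_id mulrC.
Qed.

(** For an independent family the preimage of [S] under [lin_comb] is closed by continuity and
    bounded by [independent_lower_bound]. Dependent vectors are discarded by induction on the size
    of the family. *)
Lemma finite_dimensional_compact (V : normedModType R) (S : set V) :
  closed S -> bounded_set S -> finite_dimensional_ansatz S ->
  exists n (b : 'I_n -> V) (K : set 'rV[R]_n), compact K /\ S = lin_comb b @` K.
Proof.
move=> clS /bounded_setP[M SM] [n [b Sb]].
have free_case m (b' : 'I_m -> V) : (forall c, lin_comb b' c = 0 -> c = 0) ->
    (forall v, S v -> exists c : 'I_m -> R, v = \sum_i c i *: b' i) ->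
    exists n (b : 'I_n -> V) (K : set 'rV[R]_n), compact K /\ S = lin_comb b @` K.
  move=> /independent_lower_bound[C hC] Sb'.
  exists m, b', (lin_comb b' @^-1` S); split.
    apply: bounded_closed_compact.
      apply/bounded_setP; exists (`|C| * M) => c /= Sc.
      rewrite (le_trans (hC c))// (le_trans (ler_norm _))// normrM ler_wpM2l// normr_id.
      exact: SM.
    apply: closed_comp => // c _.
    by apply: linear_rV_continuous; exact: lin_comb_linear.
  apply/seteqP; split=> [v Sv|_ [c Sc <-]//].
  have [c vE] := Sb' _ Sv.
  have vE' : lin_comb b' (\row_i c i) = v.
    by rewrite vE; apply: eq_bigr => i _; rewrite mxE.
  by exists (\row_i c i) => //=; rewrite vE'.
elim: n b Sb => [|n ih] b Sb.
  by apply: (free_case _ b) => // c _; apply/rowP => -[].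
have [inj|] := pselect (forall c, lin_comb b c = 0 -> c = 0).
  exact: (free_case _ b).
move/existsNP => [c /not_implyP[bc0 /eqP c0]].
have [j cj] : exists j, c 0 j != 0.
  apply/existsP; apply: contraNT c0; rewrite negb_exists => /forallP h.
  by apply/eqP/rowP => j; rewrite mxE; apply/eqP/negPn/h.
apply: (ih (b \o lift j)) => v /Sb[a ->].
(* The relation [c], solved for [b j], is substituted into the combination; these are the resulting
   coefficients of the remaining vectors. *)
exists (fun i => a (lift j i) - a j / c 0 j * c 0 (lift j i)) => /=.
move/eqP: bc0; rewrite /lin_comb (bigD1_ord j)//= addr_eq0 => /eqP bj.
rewrite (bigD1_ord j)//= -[in LHS](divfK cj (a j)) -scalerA bj scalerN addrC.
rewrite scaler_sumr -sumrN -big_split/=.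
by apply: eq_bigr => i _; rewrite scalerBl scalerA.
Qed.

End finite_dimension.

(** * Hoelder's inequality *)

Section Lnorm_inequalities.
Context d (T : measurableType d) (R : realType) (mu : {measure set T -> \bar R}).
Implicit Types (f g : T -> R) (p : \bar R).

Let measurable_normr_powR f (r : R) :
  measurable_fun setT f -> measurable_fun setT (fun x => `|f x| `^ r).
Proof.
move=> mf; apply: (@measurableT_comp _ _ _ _ _ _ (@powR R ^~ r)) => //.
exact: measurableT_comp.
Qed.

Lemma ae_le_Lnorm p f g : (1 <= p)%E ->
  measurable_fun setT f -> measurable_fun setT g ->
  (\forall x \ae mu, `|f x| <= `|g x|) ->
  ('N[mu]_p[EFin \o f] <= 'N[mu]_p[EFin \o g])%E.
Proof.
move=> p1 mf mg fg; rewrite unlock /Lnorm; case: p p1 => [r r1|_|//].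
  have r0 : 0 <= r by rewrite -lee_fin (le_trans _ r1).
  apply: gt0_ler_poweR; rewrite ?invr_ge0//.
  - by rewrite in_itv/= leey andbT integral_ge0// => x _; exact: poweR_ge0.
  - by rewrite in_itv/= leey andbT integral_ge0// => x _; exact: poweR_ge0.
  apply: ae_ge0_le_integral => //.
  - by move=> x _; exact: poweR_ge0.
  - exact/measurable_EFinP/measurable_normr_powR.
  - by move=> x _; exact: poweR_ge0.
  - exact/measurable_EFinP/measurable_normr_powR.
  apply: filterS fg => x fg _ /=; rewrite lee_fin ge0_ler_powR//.
case: ifPn => // _; apply: le_ess_sup.
by apply: filterS fg => x; rewrite /= lee_fin.
Qed.

Lemma normr_le_Lnormy f : measurable_fun setT f -> finite_norm mu +oo f ->
  \forall x \ae mu, `|f x| <= fine ('N[mu]_+oo[EFin \o f])%E.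
Proof.
move=> mf ff; have Nge := Lnorm_ge0 mu +oo (EFin \o f).
(* The norm at exponent +oo is an essential supremum only on a space of positive measure. On a null
   space every property holds almost everywhere. *)
have [muT|muT] := boolP (0 < mu setT)%E; last first.
  exists setT; split => //.
  by apply/eqP; rewrite eq_le measure_ge0 leNgt muT.
have := ess_sup_ge mu (abse \o (EFin \o f)); apply: filterS => x /=.
move: ff Nge; rewrite /finite_norm unlock /= muT => ff Nge.
by rewrite -lee_fin fineK// ge0_fin_numE.
Qed.

(** The factor [g] is bounded almost everywhere by its norm, which is then taken out of the
    integral. *)
Lemma hoelder1y f g : measurable_fun setT f -> measurable_fun setT g ->
  finite_norm mu +oo g ->
  ('N[mu]_1[EFin \o (f \* g)%R] <= 'N[mu]_1[EFin \o f] * 'N[mu]_+oo[EFin \o g])%E.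
Proof.
move=> mf mg fg; have Nge := Lnorm_ge0 mu +oo (EFin \o g).
rewrite -[X in (_ * X)%E]fineK ?ge0_fin_numE// !Lnorm1 -ge0_integralZr//; last first.
- by rewrite lee_fin fine_ge0.
- exact/measurableT_comp/measurable_EFinP.
apply: ae_ge0_le_integral => //.
- exact/measurableT_comp/measurable_EFinP/measurable_funM.
- by move=> x _; rewrite mule_ge0// lee_fin fine_ge0.
- by apply: emeasurable_funM => //; exact/measurableT_comp/measurable_EFinP.
apply: filterS (normr_le_Lnormy mg fg) => x gx _ /=.
by rewrite lee_fin normrM ler_wpM2l.
Qed.

(** The pairs (1, +oo) and (+oo, 1) are covered by [hoelder1y]. Otherwise both exponents are real
    and [hoelder] applies. *)
Lemma hoelder_ext p f g : (1 <= p)%E ->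
  measurable_fun setT f -> measurable_fun setT g ->
  finite_norm mu p f -> finite_norm mu (hoelder_conjugate p) g ->
  ('N[mu]_1[EFin \o (f \* g)%R] <=
   'N[mu]_p[EFin \o f] * 'N[mu]_(hoelder_conjugate p)[EFin \o g])%E.
Proof.
move=> p1 mf mg ff fg.
have [p1E|pn1] := eqVneq p 1%E.
  by move: fg; rewrite p1E hoelder_conjugate1 => fg; exact: hoelder1y.
have [pyE|pny] := eqVneq p +oo%E.
  move: ff; rewrite pyE hoelder_conjugatey => ff; rewrite muleC.
  rewrite (_ : f \* g = g \* f); first exact: hoelder1y.
  by apply/funext => x /=; rewrite mulrC.
have qny : hoelder_conjugate p != +oo%E.
  by apply: contra_neq pn1 => /hoelder_conjugate_eqy.
have q1 := hoelder_conj_ge1 p1.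
have pNy : (-oo < p)%E by rewrite (lt_le_trans _ p1)// ltNyr.
have := hoelder_conjugate_eq1 pNy.
move: ff fg pn1 pny qny p1 q1 {pNy}; move: (hoelder_conjugate p) => q.
case: p => [r| |]// ff fg _ _; case: q fg => [s| |]// fg _ r1 s1.
have r0 : 0 < r by rewrite -lte_fin (lt_le_trans _ r1)// lte01.
have s0 : 0 < s by rewrite -lte_fin (lt_le_trans _ s1)// lte01.
rewrite eqe gt_eqF// !inver !gt_eqF// => /(_ isT) [rs].
exact: hoelder.
Qed.

End Lnorm_inequalities.

Section Lspace_pairing.
Context d (T : measurableType d) (R : realType) (mu : {measure set T -> \bar R}).
Context (p : \bar R) (p1 : (1 <= p)%E).
Local Notation L0 := (@aeEqMfun _ _ R T (measurableTypeR R) mu).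
Local Notation Lp := (LspaceType mu p1).
Local Notation Loo := (LspaceType mu (leey 1%E)).

Lemma Lspace_normE (f : Lp) :
  (`|f|)%:E = ('N[mu]_p[EFin \o (f : T -> R)])%E.
Proof.
rewrite [`|f|]/(Lspace_norm f) /Lspace_norm fineK// ge0_fin_numE ?Lnorm_ge0//.
exact: Lebesgue_finite.
Qed.

(** Hoelder's inequality bounds the L^1 norm of the product. This gives integrability and, as the
    integral is at most that norm, the bound that makes [g] a continuous functional. *)
Lemma Lspace_pairing (g : L0) (f : Lp) :
  finite_norm mu (hoelder_conjugate p) (g : T -> R) ->
  mu.-integrable setT (fun x => ((g x : R) * (f x : R))%:E) /\
  `|\int[mu]_x ((g x : R) * (f x : R))| <=
    fine ('N[mu]_(hoelder_conjugate p)[EFin \o (g : T -> R)])%E * `|f|.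
Proof.
move=> fg; pose h x : R := (f x : R) * (g x : R).
have -> : (fun x => (g x : R) * (f x : R)) = h by apply/funext => x; rewrite mulrC.
have hE : (fun x => ((g x : R) * (f x : R))%:E) = EFin \o h.
  by apply/funext => x; rewrite mulrC.
have mf := @L0_measurable _ _ _ _ (f : L0).
have mg := @L0_measurable _ _ _ _ g.
have mh : measurable_fun setT h by exact: measurable_funM.
have Ng0 := Lnorm_ge0 mu (hoelder_conjugate p) (EFin \o (g : T -> R)).
have hle : ('N[mu]_1[EFin \o h] <=
    (fine ('N[mu]_(hoelder_conjugate p)[EFin \o (g : T -> R)]) * `|f|)%:E)%E.
  rewrite EFinM fineK ?ge0_fin_numE// Lspace_normE muleC.
  apply: hoelder_ext => //; exact: Lebesgue_finite.
have ih : mu.-integrable setT (EFin \o h).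
  apply/Lfun1_integrable; apply/andP; split; rewrite inE//=.
  by rewrite /finite_norm (le_lt_trans hle)// ltry.
rewrite hE; split => //.
rewrite -lee_fin (le_trans _ hle)// Lnorm1 (EFin_normr_Rintegral _ ih)//.
by apply: le_abse_integral => //; exact/measurable_EFinP.
Qed.

Lemma Loo_ae_bound (z : Loo) : \forall x \ae mu, `|z x : R| <= `|z|.
Proof.
have fz : finite_norm mu +oo (z : T -> R) by exact: Lebesgue_finite.
exact: (normr_le_Lnormy (L0_measurable (z : L0)) fz).
Qed.

Lemma finite_norm_bounded (f g : L0) (M : R) :
  (\forall x \ae mu, `|f x : R| <= `|M * (g x : R)|) ->
  finite_norm mu p (g : T -> R) -> finite_norm mu p (f : T -> R).
Proof.
move=> fg gfin; have mg := L0_measurable g.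
have gL : (g : T -> R) \in Lfun mu p by apply/andP; split; rewrite inE.
have : M *: (g : T -> R) \in Lfun mu p.
  have [h0] := @Lfun_submod_closed _ _ _ mu p p1.
  by move=> /(_ M (g : T -> R) 0 gL h0); rewrite addr0.
case/andP => /[1!inE] mMg; rewrite inE/=; apply: le_lt_trans.
apply: ae_le_Lnorm => //; exact: L0_measurable.
Qed.

Lemma finite_norm_mulLoo (g : L0) (z : Loo) :
  finite_norm mu p (g : T -> R) ->
  finite_norm mu p ((g * (z : L0) : L0) : T -> R).
Proof.
apply: (@finite_norm_bounded _ _ `|z|).
apply: (filterS2 _ _ (L0_M g (z : L0)) (Loo_ae_bound z)) => x /= gz zx.
rewrite (gz Logic.I)/= !normrM normr_id mulrC ler_wpM2r//.
Qed.

End Lspace_pairing.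

(** * Cell averages *)

Section L0_integrals.
Context d (T : measurableType d) (R : realType) (mu : {measure set T -> \bar R}).
Local Notation L0 := (@aeEqMfun _ _ R T (measurableTypeR R) mu).

(** On a space of finite measure L^p is contained in L^1. Integrability is what makes cell averages
    linear. *)
Lemma Lspace_integrable (p : \bar R) (p1 : (1 <= p)%E) (f : LspaceType mu p1) :
  mu setT \is a fin_num -> mu.-integrable setT (EFin \o ((f : L0) : T -> R)).
Proof.
move=> muT; apply/Lfun1_integrable; apply: (Lfun_subset (lexx _) p1 muT p1).
by apply/andP; split; rewrite inE/=; [exact: L0_measurable|exact: Lebesgue_finite].
Qed.

Lemma ae_eq_Rintegral (D : set T) (f g : T -> R) : measurable D ->
  measurable_fun setT f -> measurable_fun setT g ->
  (\forall x \ae mu, D x -> f x = g x) ->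
  \int[mu]_(x in D) f x = \int[mu]_(x in D) g x.
Proof.
move=> mD mf mg fg; congr fine; apply: ae_eq_integral => //.
- by apply/measurable_EFinP; exact: measurable_funS mf.
- by apply/measurable_EFinP; exact: measurable_funS mg.
- by apply: filterS fg => x fg Dx; rewrite fg.
Qed.

Lemma ae_eq_integrable (f g : T -> R) :
  measurable_fun setT f -> measurable_fun setT g ->
  (\forall x \ae mu, f x = g x) ->
  mu.-integrable setT (EFin \o g) -> mu.-integrable setT (EFin \o f).
Proof.
move=> mf mg fg /integrableP[_ gfin]; apply/integrableP; split.
  exact/measurable_EFinP.
rewrite (ae_eq_integral (abse \o (EFin \o g)))//.
- exact/measurableT_comp/measurable_EFinP.
- exact/measurableT_comp/measurable_EFinP.
- by apply: filterS fg => x fg _ /=; rewrite fg.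
Qed.

Lemma Rintegral_linear (D : set T) (f g h : T -> R) (a : R) : measurable D ->
  measurable_fun setT h ->
  mu.-integrable D (EFin \o f) -> mu.-integrable D (EFin \o g) ->
  measurable_fun setT f -> measurable_fun setT g ->
  (\forall x \ae mu, h x = a * f x + g x) ->
  \int[mu]_(x in D) h x = a * \int[mu]_(x in D) f x + \int[mu]_(x in D) g x.
Proof.
move=> mD mh If Ig mf mg hE.
rewrite -RintegralZl// -RintegralD//; last first.
  by have := integrableZl mD a If; apply: eq_integrable => // x _; rewrite /= EFinM.
apply: ae_eq_Rintegral => //; last by apply: filterS hE => x + _.
by apply: measurable_funD => //; exact: measurable_funM.
Qed.

Lemma L0_comb (a : R) (f g : L0) :
  \forall x \ae mu, ((a *: f + g : L0) x : R) = a * (f x : R) + (g x : R).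
Proof.
apply: (filterS2 _ _ (L0_D (a *: f) g) (L0_Z a f)) => x e1 e2.
by rewrite e1//= e2.
Qed.

Lemma L0_sum n (f : 'I_n -> L0) :
  \forall x \ae mu, ((\sum_i f i : L0) x : R) = \sum_i (f i x : R).
Proof.
elim: n f => [|n ih] f.
  rewrite big_ord0; apply: filterS (L0_0 mu) => x e; rewrite big_ord0; exact: e.
rewrite big_ord_recl.
apply: (filterS2 _ _ (L0_D (f ord0) (\sum_i f (lift ord0 i))) (ih (f \o lift ord0))).
by move=> x e1 e2; rewrite e1//= e2 big_ord_recl.
Qed.

End L0_integrals.

(** * McCormick inequalities between real numbers *)

Section mccormick.
Context {R : realType}.

(** The McCormick envelope of the graph of the product over a box. It is what [mcc] says on one cell
    once functions are replaced by their constant values there. *)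
Definition mccormick (ul uu wl wu u w z : R) :=
  [/\ ul * w + wl * u - ul * wl - z <= 0,
      uu * w + wu * u - uu * wu - z <= 0,
      z - uu * w - wl * u + uu * wl <= 0 &
      z - ul * w - wu * u + ul * wu <= 0].

(** Each left-hand side is minus a product of two nonnegative distances to the bounds, for example
    [- ((u - ul) * (w - wl))] for the first. *)
Lemma mccormick_product (ul uu wl wu u w : R) :
  ul <= u <= uu -> wl <= w <= wu -> mccormick ul uu wl wu u w (u * w).
Proof. by move=> /andP[? ?] /andP[? ?]; split; nra. Qed.

Lemma mccormick_convex (ul uu wl wu t u w z u' w' z' : R) : 0 <= t -> t <= 1 ->
  mccormick ul uu wl wu u w z -> mccormick ul uu wl wu u' w' z' ->
  mccormick ul uu wl wu (t * u + (1 - t) * u') (t * w + (1 - t) * w')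
    (t * z + (1 - t) * z').
Proof.
move=> t0 t1 [a b c e] [a' b' c' e'].
have h (x y : R) : x <= 0 -> y <= 0 -> t * x + (1 - t) * y <= 0.
  by move=> x0 y0; rewrite -[0]addr0 lerD// mulr_ge0_le0// subr_ge0.
split; [move: (h _ _ a a')|move: (h _ _ b b')|move: (h _ _ c c')|
  move: (h _ _ e e')]; congr (_ <= _); ring.
Qed.

Lemma closed_mccormick (T : topologicalType) (ul uu wl wu : R) (u w z : T -> R) :
  continuous u -> continuous w -> continuous z ->
  closed [set x | mccormick ul uu wl wu (u x) (w x) (z x)].
Proof.
move=> cu cw cz.
have h (a b c k : R) : closed [set x | a * u x + b * w x + c * z x + k <= 0].
  apply: (@closed_comp _ _ (fun x => a * u x + b * w x + c * z x + k) [set y | y <= 0]).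
    move=> x _; apply: (@cvgD _ _ _ (nbhs x)); last exact: cvg_cst.
    have cM (s : R) (v : T -> R) : continuous v -> s * v y @[y --> x] --> s * v x.
      by move=> cv; apply: (@cvgM _ _ (nbhs x)); [exact: cvg_cst|exact: cv].
    by do 2 (apply: (@cvgD _ _ _ (nbhs x)); last exact: cM); exact: cM.
  exact: closed_le.
rewrite [X in closed X](_ : _ =
  ([set x | wl * u x + ul * w x + (-1) * z x + (- (ul * wl)) <= 0] `&`
   [set x | wu * u x + uu * w x + (-1) * z x + (- (uu * wu)) <= 0]) `&`
  ([set x | (- wl) * u x + (- uu) * w x + 1 * z x + uu * wl <= 0] `&`
   [set x | (- wu) * u x + (- ul) * w x + 1 * z x + ul * wu <= 0])).
  by do 2 apply: closedI; exact: h.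
apply/seteqP; split=> x /=.
  by move=> [a b c e]; do 2 split; [move: a|move: b|move: c|move: e]; congr (_ <= _); ring.
by move=> [[a b] [c e]]; split; [move: a|move: b|move: c|move: e]; congr (_ <= _); ring.
Qed.

End mccormick.

(** * Finite measure of the domain and reduction to cell averages *)

Section domain.
Context {R : realType} {d : nat} (Omega : lipschitz_domain R d).
Local Notation mu := (domain_measure Omega).

Lemma domain_measure_fin : mu setT \is a fin_num.
Proof.
have [M OM] := (bounded_setP (Omega : set 'rV[R]_d)).1 (domain_bounded Omega).
rewrite ge0_fin_numE ?measure_ge0//.
(* The maximum norm bounds every coordinate, so the domain lies in this cube of finite measure. *)
pose B : set 'rV[R]_d := [set x | forall i, `[- M, M]%classic (x ord0 i)].
have mB : measurable B.
  apply: (@measurable_box _ _ (fun=> `[- M, M]%classic : set (measurableTypeR R))) => i.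
  exact: measurable_itv.
have : (mu setT <= lebesgue_measure_rV d B)%E.
  rewrite [leLHS]/(lebesgue_measure_rV d (setT `&` (Omega : set _))) setTI.
  apply: le_measure; rewrite ?inE//; first exact: measurable_domain.
  move=> x /OM xM i /=; rewrite in_itv/= -ler_norml (le_trans _ xM)//.
  rewrite [leRHS]/Num.norm/= mx_normrE.
  by apply/bigmax_geP; right; exists (ord0, i).
move=> /le_lt_trans; apply.
rewrite (@lebesgue_measure_box _ _ (fun=> `[- M, M]%classic)); last first.
  by move=> i; exact: measurable_itv.
rewrite -ge0_fin_numE; last by apply: prode_ge0 => i _; exact: measure_ge0.
apply: prode_fin_num => i _; rewrite lebesgue_measure_itv/=.
by case: ifPn => _; rewrite ?fin_numB.
Qed.

Context {N : nat} (Q : mesh Omega N).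

Lemma cell_measure_fin i : mu (Q i) \is a fin_num.
Proof.
rewrite ge0_fin_numE ?measure_ge0//.
apply: (@le_lt_trans _ _ (mu setT)).
  by apply: le_measure; rewrite ?inE//; exact: measurable_cell.
by rewrite -ge0_fin_numE ?measure_ge0// domain_measure_fin.
Qed.

Lemma cell_average_linear (a : R) (f g : L0 R Omega) i :
  mu.-integrable setT (EFin \o (f : _ -> R)) ->
  mu.-integrable setT (EFin \o (g : _ -> R)) ->
  cell_average Q (a *: f + g) i = a * cell_average Q f i + cell_average Q g i.
Proof.
move=> If Ig; have mQ := measurable_cell Q i.
rewrite /cell_average (@Rintegral_linear _ _ _ _ _ (f : _ -> R) (g : _ -> R) _ a) //.
- by rewrite mulrDr mulrCA.
- exact: L0_measurable.
- exact: integrableS If.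
- exact: integrableS Ig.
- exact: L0_measurable.
- exact: L0_measurable.
- exact: L0_comb.
Qed.

(** The cells are disjoint, so on [Q i] only the indicator of that cell contributes to the sum. *)
Lemma local_averageE (v : L0 R Omega) i :
  cell_constant Q i (local_average Q v) (cell_average Q v i).
Proof.
have h j : \forall x \ae mu,
    ((cell_average Q v j *: cell_indicator Q j : L0 R Omega) x : R) =
    cell_average Q v j * \1_(Q j) x.
  apply: (filterS2 _ _ (L0_Z (cell_average Q v j) (cell_indicator Q j))
    (L0_ofE mu (@measurable_indic _ 'rV[R]_d R setT (Q j) (measurable_cell Q j)))).
  by move=> x e1 e2; rewrite e1// e2.
have h' : \forall x \ae mu, forall j,
    ((cell_average Q v j *: cell_indicator Q j : L0 R Omega) x : R) =
    cell_average Q v j * \1_(Q j) x.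
  by apply: filter_forall.
have := L0_sum (fun j => (cell_average Q v j *: cell_indicator Q j : L0 R Omega)).
apply: filterS2 h' => x e1 e2 Qx.
rewrite /local_average e2 (bigD1 i)//= e1 indicE mem_set// mulr1 big1 ?addr0// => j ji.
rewrite e1 indicE memNset ?mulr0// => Qjx.
have [_ /trivIsetP/(_ i j Logic.I Logic.I) QQ _] := mesh_partition Q.
have : set0 x by rewrite -QQ// eq_sym.
by [].
Qed.

(** A cell has positive measure, so it cannot be contained in the exceptional null set. This turns
    inequalities almost everywhere on a cell into inequalities between numbers. *)
Lemma cell_ae_cst (P : Prop) i : (\forall x \ae mu, Q i x -> P) -> P.
Proof.
move=> [A [mA A0 QA]]; apply: contrapT => nP.
have := cell_measure_gt0 Q i; apply/negP; rewrite -leNgt -A0.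
apply: le_measure; rewrite ?inE//; first exact: measurable_cell.
by move=> x Qx; apply: QA => /= /(_ Qx).
Qed.

Lemma cell_constant_uniq (z : L0 R Omega) i a b :
  cell_constant Q i z a -> cell_constant Q i z b -> a = b.
Proof.
move=> za zb; apply: (@cell_ae_cst _ i).
by apply: filterS2 za zb => x + + Qx => /(_ Qx) <- /(_ Qx) <-.
Qed.

Lemma cell_valueE (z : L0 R Omega) i a :
  cell_constant Q i z a -> cell_value Q i z = a.
Proof.
move=> za; rewrite /cell_value; case: xgetP => [b _ zb|/(_ a)/=]; last by [].
exact: (cell_constant_uniq zb za).
Qed.

Lemma cell_average_constant (z : L0 R Omega) i a :
  cell_constant Q i z a -> cell_average Q z i = a.
Proof.
move=> za; rewrite /cell_average.
rewrite (@ae_eq_Rintegral _ _ _ _ _ _ (cst a))//; last first.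
- exact: L0_measurable.
- exact: measurable_cell.
rewrite Rintegral_cst; last exact: measurable_cell.
rewrite mulrCA mulVf ?mulr1// gt_eqF// fine_gt0// cell_measure_gt0.
by rewrite -ge0_fin_numE ?measure_ge0// cell_measure_fin.
Qed.

(** On a cell the local averages of [u] and [w] are the constant cell averages, and [z] equals its
    own average. Passing from [cell_value] to the average of [z] makes all three entries linear in
    the functions. *)
Lemma mccP (ul uu wl wu : 'I_N -> R) i (u w z : L0 R Omega) :
  piecewise_constant Q z ->
  mcc Q ul uu wl wu i u w z <->
  mccormick (ul i) (uu i) (wl i) (wu i)
    (cell_average Q u i) (cell_average Q w i) (cell_average Q z i).
Proof.
move=> /(_ i)[c zc]; rewrite /= (cell_average_constant zc) /mcc (cell_valueE zc).
split => [h|h].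
  apply: (@cell_ae_cst _ i).
  apply: (filterS3 _ _ (local_averageE u i) (local_averageE w i) h).
  by move=> x + + + Qx => /(_ Qx) -> /(_ Qx) -> /(_ Qx).
apply: filterS2 (local_averageE u i) (local_averageE w i) => x + + Qx.
by move=> /(_ Qx) -> /(_ Qx) ->.
Qed.

End domain.

(** * The state equation *)

Section state.
Context {R : realType} {d : nat} (Omega : lipschitz_domain R d).
Local Notation mu := (domain_measure Omega).
Context {U : normedModType R} (emb : U -> L0 R Omega).

Lemma L0_mulrD (a : R) (f g h : L0 R Omega) :
  f * (a *: g + h) = a *: (f * g) + f * h.
Proof.
apply: L0P; have e1 := L0_M f (a *: g + h); have e2 := L0_comb a g h.
have e3 := L0_comb a (f * g) (f * h).
apply: (filterS5 _ _ e1 e2 e3 (L0_M f g) (L0_M f h)) => x E1 E2 E3 E4 E5 _.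
by rewrite E1//= E2 E3 E4//= E5//= mulrDr mulrCA.
Qed.

Lemma represents_uniq (g : L0 R Omega) (phi psi : dual_space U) :
  represents emb g phi -> represents emb g psi -> phi = psi.
Proof.
move=> gphi gpsi; apply/val_inj/funext => v /=.
by rewrite (gphi v).2 (gpsi v).2.
Qed.

Lemma represents_linear (a : R) (g h : L0 R Omega) (phi psi : dual_space U) :
  represents emb g phi -> represents emb h psi ->
  represents emb (a *: g + h) (a *: phi + psi).
Proof.
move=> gphi hpsi v; have [Ig gE] := gphi v; have [Ih hE] := hpsi v.
have mM (f : L0 R Omega) :
  measurable_fun setT (fun x => (f x : R) * (emb v x : R)).
  by apply: measurable_funM; exact: L0_measurable.
have ae : \forall x \ae mu, ((a *: g + h : L0 R Omega) x : R) * (emb v x : R) =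
    a * ((g x : R) * (emb v x : R)) + (h x : R) * (emb v x : R).
  by apply: filterS (L0_comb a g h) => x ->; rewrite mulrDl mulrA.
split; last first.
  rewrite (Rintegral_linear measurableT (mM (a *: g + h)) Ig Ih (mM g) (mM h) ae)//.
  by rewrite -gE -hE.
apply: (ae_eq_integrable (mM (a *: g + h)) _ ae).
  by apply: measurable_funD => //; exact: measurable_funM.
have := integrableD measurableT (integrableZl measurableT a Ig) Ih.
by apply: eq_integrable => // x _; rewrite /= EFinD EFinM.
Qed.

Lemma represents_combination2 (a b : R) (g h : L0 R Omega) (phi psi : dual_space U) :
  represents emb g phi -> represents emb h psi ->
  represents emb (a *: g + b *: h) (a *: phi + b *: psi).
Proof.
(* The multiple [b *: h] is obtained as [(b - 1) *: h + h]. *)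
move=> gphi hpsi; have := represents_linear (b - 1) hpsi hpsi.
rewrite -{2}[h]scale1r -{2}[psi]scale1r -!scalerDl subrK.
exact: represents_linear.
Qed.

(** Since [z] is bounded, [f0 * z] has a finite norm for the exponent conjugate to [p]. Hoelder's
    inequality and the continuous embedding then bound the integral by a multiple of the norm in
    [U]. *)
Lemma represents_exists (p : \bar R) (p1 : (1 <= p)%E) (embp : U -> Lp Omega p1)
    (f0 : L0 R Omega) (z : Loo Omega) :
  linear embp -> continuous embp ->
  (forall u, (embp u : L0 R Omega) = emb u) ->
  finite_norm mu (hoelder_conjugate p) (f0 : _ -> R) ->
  exists phi : dual_space U, represents emb (f0 * (z : L0 R Omega)) phi.
Proof.
move=> le ce eE ff0.
have ff := finite_norm_mulLoo (hoelder_conj_ge1 p1) z ff0.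
have [C C0 eC] := linear_continuous_bound le ce.
set g : L0 R Omega := f0 * _ in ff *.
pose F (u : U) : R^o := \int[mu]_x ((g x : R) * (emb u x : R)).
have mM u : measurable_fun setT (fun x => (g x : R) * (emb u x : R)).
  by apply: measurable_funM; exact: L0_measurable.
have IF u : mu.-integrable setT (fun x => ((g x : R) * (emb u x : R))%:E).
  by rewrite -eE; exact: (Lspace_pairing (embp u) ff).1.
have lF : linear F.
  move=> a u v; rewrite -[RHS]/(a * F u + F v).
  apply: (Rintegral_linear measurableT (mM _) (IF u) (IF v) (mM u) (mM v)).
  rewrite -3!eE le; apply: filterS (L0_comb a (embp u : L0 R Omega) (embp v)) => x.
  move=> e; rewrite [X in _ * X]e mulrDr mulrCA//.
have cF : continuous F.
  apply: (@linear_continuous_of_bound _ _ _ F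
    (fine ('N[mu]_(hoelder_conjugate p)[EFin \o (g : _ -> R)])%E * C)) => // u.
  rewrite -mulrA (le_trans _ (ler_wpM2l _ (eC u)))//; last first.
    by rewrite fine_ge0// Lnorm_ge0.
  by rewrite /F -eE; exact: (Lspace_pairing (embp u) ff).2.
have FP : (F : U -> R^o) \in @dual_pred R U by rewrite inE; split.
by exists (Dual FP) => v; split.
Qed.

End state.

(** * Compactness and convexity of the relaxation *)

Section normed_spaces.
Context {R : realType}.

(** A point of the closure has distance zero from [S], hence equals its projection, which lies in
    [S]. *)
Lemma metric_projection_closed (V : normedModType R) (S : set V) (P : V -> V) :
  metric_projection S P -> closed S.
Proof.
move=> PP x clx; have [SPx Pmin] := PP x.
suff -> : x = P x by [].
apply/eqP; rewrite -subr_eq0 -normr_le0; apply/ler_addgt0Pr => e e0; rewrite add0r.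
have [y [Sy]] := clx _ (nbhsx_ballx x e e0).
by rewrite -ball_normE/= => /ltW; apply: le_trans; exact: Pmin.
Qed.

Lemma normB_convex (V : lmodType R) (W : normedModType R) (f : V -> W) (y : W)
    (D : set V) :
  linear f -> @convex_function R V D (fun v => `|f v - y|).
Proof.
move=> lf t u v _ _; rewrite convRE.
rewrite [X in f X](_ : _ = t%:num *: u + (1 - t%:num) *: v)//.
rewrite linear_combination2//.
have -> : t%:num *: f u + (1 - t%:num) *: f v - y =
    t%:num *: (f u - y) + (1 - t%:num) *: (f v - y).
  rewrite !scalerBr addrACA -opprD -scalerDl addrC [t%:num + _]addrC.
  by rewrite subrK scale1r addrC.
rewrite (le_trans (ler_normD _ _))// !normrZ ger0_norm// ger0_norm//.
Qed.

Lemma linear_inv (V W : lmodType R) (f : V -> W) (g : W -> V) :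
  linear f -> cancel f g -> cancel g f -> linear g.
Proof. by move=> lf fK gK a x y; rewrite -[LHS]fK -{1}[x]gK -{1}[y]gK -lf !fK. Qed.

End normed_spaces.

Section essentially_bounded.
Context d (T : measurableType d) (R : realType) (mu : {measure set T -> \bar R}).
Local Notation L0 := (@aeEqMfun _ _ R T (measurableTypeR R) mu).

Lemma finite_normy_bounded (f : T -> R) (M : R) :
  (\forall x \ae mu, `|f x| <= M) -> finite_norm mu +oo f.
Proof.
move=> fM; rewrite /finite_norm unlock /=; case: ifPn => // _.
apply: (@le_lt_trans _ _ M%:E); last exact: ltry.
by apply/ess_supP; apply: filterS fM => x; rewrite /= lee_fin.
Qed.

(** On a space of finite measure the constant [M] has a finite L^2 norm, which dominates. This turns
    the pointwise bounds on controls into a norm bound. *)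
Lemma L2_norm_bound (M : R) : mu setT \is a fin_num ->
  exists C, forall f : LspaceType2 mu,
    (\forall x \ae mu, `|(f : L0) x : R| <= M) -> `|f| <= C.
Proof.
move=> muT.
have cL : (cst M : T -> R) \in Lfun mu 2%:E.
  apply: (Lfun_subset (lee1n 2) (leey 1%E) muT (leey _)).
  apply/andP; split; rewrite inE//=.
  by apply: (@finite_normy_bounded _ `|M|); exact: nearW.
exists (fine ('N[mu]_2%:E[EFin \o (cst M : T -> R)])%E) => f fM.
rewrite -lee_fin Lspace_normE fineK; last first.
  rewrite ge0_fin_numE ?Lnorm_ge0//.
  by move: cL => /andP[_]; rewrite inE.
apply: ae_le_Lnorm => //; first by rewrite lee1n.
  exact: L0_measurable.
by apply: filterS fM => x /le_trans; apply; exact: ler_norm.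
Qed.

Lemma val_linear (p : \bar R) (p1 : (1 <= p)%E) :
  linear (fun f : LspaceType mu p1 => (f : L0)).
Proof. by move=> a f g; rewrite -[LHS]/(val (a *: f + g)) linearP. Qed.

End essentially_bounded.

(** * Piecewise constant functions on the mesh *)

Section piecewise_constant.
Context {R : realType} {d : nat} (Omega : lipschitz_domain R d).
Local Notation mu := (domain_measure Omega).
Context {N : nat} (Q : mesh Omega N).

(** The complement of the domain is a null set for [mu], and the finitely many cells cover the
    domain. *)
Lemma ae_cellwise (P : set 'rV[R]_d) :
  (forall i, \forall x \ae mu, Q i x -> P x) -> \forall x \ae mu, P x.
Proof.
move=> QP.
have aeO : \forall x \ae mu, (Omega : set _) x.
  exists (~` (Omega : set 'rV[R]_d)); split => //.
    by apply: measurableC; exact: measurable_domain.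
  rewrite [LHS]/(lebesgue_measure_rV d (~` (Omega : set _) `&` (Omega : set _))).
  by rewrite setICl; exact: (measure0 (lebesgue_measure_rV d)).
have : \forall x \ae mu, forall i, Q i x -> P x by exact: filter_forall.
apply: filterS2 aeO => x Ox QPx.
have [cQ _ _] := mesh_partition Q.
by move: Ox; rewrite -cQ => -[i _ /QPx].
Qed.

Lemma piecewise_constant_average (z : L0 R Omega) i :
  piecewise_constant Q z -> cell_constant Q i z (cell_average Q z i).
Proof. by move=> /(_ i)[c zc]; rewrite (cell_average_constant zc). Qed.

Lemma local_average_id (z : L0 R Omega) :
  piecewise_constant Q z -> local_average Q z = z.
Proof.
move=> pz; apply: L0P.
suff : \forall x \ae mu, (local_average Q z x : R) = z x by apply: filterS => x + _.
apply: ae_cellwise => i.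
apply: filterS2 (local_averageE Q z i) (piecewise_constant_average i pz) => x + + Qx.
by move=> /(_ Qx) -> /(_ Qx) ->.
Qed.

(** The cell indicators span: a piecewise constant function equals its local average, whose
    coefficients are the cell averages. *)
Lemma piecewise_constant_ansatz (Z : set (Loo Omega)) :
  (forall z, Z z -> piecewise_constant Q z) -> finite_dimensional_ansatz Z.
Proof.
move=> pZ.
have iL i : cell_indicator Q i \in finL0 mu +oo.
  rewrite inE; apply: (@finite_normy_bounded _ _ _ _ _ 1).
  apply: filterS (L0_ofE mu (@measurable_indic _ 'rV[R]_d R setT (Q i)
    (measurable_cell Q i))) => x ->//.
  by rewrite indicE normr_nat lern1 leq_b1.
exists N, (fun i => Lspace_Sub (leey 1%E) (iL i)) => z Zz.
exists (cell_average Q (z : L0 R Omega)); apply: val_inj.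
rewrite -[LHS](local_average_id (pZ _ Zz)) /local_average.
by rewrite [RHS](linear_sumZ _ _ (@val_linear _ _ _ _ _ _)).
Qed.

Lemma product_cell_constant (u w : L0 R Omega) i :
  cell_constant Q i (local_average Q u * local_average Q w)
    (cell_average Q u i * cell_average Q w i).
Proof.
apply: (filterS3 _ _ (L0_M (local_average Q u) (local_average Q w))
  (local_averageE Q u i) (local_averageE Q w i)) => x e1 e2 e3 Qx.
by rewrite e1//= e2// e3.
Qed.

Lemma mcc_product (ul uu wl wu : 'I_N -> R) i (u w : L0 R Omega) :
  (\forall x \ae mu, Q i x -> ul i <= local_average Q u x <= uu i) ->
  (\forall x \ae mu, Q i x -> wl i <= local_average Q w x <= wu i) ->
  mcc Q ul uu wl wu i u w (local_average Q u * local_average Q w).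
Proof.
move=> uB wB; have pz : piecewise_constant Q (local_average Q u * local_average Q w).
  by move=> j; eexists; exact: product_cell_constant.
apply/(mccP _ _ _ _ _ _ _ pz) => /=.
rewrite (cell_average_constant (product_cell_constant u w i)).
apply: mccormick_product.
  apply: (@cell_ae_cst _ _ _ _ Q _ i).
  by apply: filterS2 (local_averageE Q u i) uB => x + + Qx => /(_ Qx) -> /(_ Qx).
apply: (@cell_ae_cst _ _ _ _ Q _ i).
by apply: filterS2 (local_averageE Q w i) wB => x + + Qx => /(_ Qx) -> /(_ Qx).
Qed.

End piecewise_constant.

(** * Convexity of the relaxation, existence of a minimizer, and feasibility of the product *)

Theorem proposition3p12 (R : realType) (d : nat) (Omega : lipschitz_domain R d)
    (p : \bar R) (p1 : (1 <= p)%E)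
    (U Y : completeNormedModType R)
    (emb2 : {linear U -> L2 Omega}) (embp : {linear U -> Lp Omega p1})
    (emb2_inj : injective emb2) (emb2_cont : continuous emb2)
    (embp_cont : continuous embp)
    (embE : forall u : U, (embp u : L0 R Omega) = emb2 u)
    (U_reflexive : reflexive_space U)
    (T : {linear L2 Omega -> Y}) (T_cont : continuous T) (ydelta : Y)
    (A : U -> dual_space U) (A_iso : isomorphism A)
    (f0 : L0 R Omega)
    (f0_fin : finite_norm (domain_measure Omega) (hoelder_conjugate p)
       (f0 : 'rV[R]_d -> R))
    (f0_ge0 : \forall x \ae domain_measure Omega, (0 : R) <= f0 x)
    (f1 : dual_space U)
    (wl wu : Loo Omega) (Wad : set (Loo Omega)) (Wad_neq0 : Wad !=set0)
    (Wad_bound : forall w, Wad w ->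
       \forall x \ae domain_measure Omega, (wl x : R) <= w x <= (wu x : R))
    (Nh Ntau : nat) (Qh : mesh Omega Nh) (Qtau : mesh Omega Ntau)
    (h tau : R) (hE : h = mesh_size Qh) (tauE : tau = mesh_size Qtau)
    (Vh : set (L2 Omega)) (PVh PWh : L2 Omega -> L2 Omega) :
  let mu := domain_measure Omega in
  let Ptau := local_average Qtau in
  let emb (u : U) : L0 R Omega := emb2 u in
  let E (u : U) (w : L0 R Omega) := state_equation emb A f0 f1 u (emb u * w) in
  let Etau (u : U) (w : L0 R Omega) :=
    state_equation emb A f0 f1 u (Ptau (emb u) * Ptau w) in
  let Wh : set (L0 R Omega) := (\val @` Wad) `&` (\val @` Vh) in
  forall
    (PVhP : metric_projection Vh PVh)
    (PWhP : metric_projection [set v : L2 Omega | Wh v] PWh)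
    (ul uu : Loo Omega) (uli uui wli wui : 'I_Ntau -> R)
    (Zad Ztau : set (Loo Omega))
    (A1 : [/\ closed Vh, convex_set Vh & finite_dimensional_ansatz Vh])
    (A2 : forall w, Wad w -> (exists! u, E u w) /\ (exists! u, Etau u w))
    (A3 : forall w u, Wad w -> E u w ->
       \forall x \ae mu, (ul x : R) <= emb u x <= (uu x : R))
    (A4 : forall w u, Wad w -> Etau u w -> forall i,
       \forall x \ae mu, Qtau i x -> uli i <= Ptau (emb u) x <= uui i)
    (A5 : forall w, Wh w -> forall i,
       \forall x \ae mu, Qtau i x -> wli i <= Ptau w x <= wui i)
    (A6 : forall w : L2 Omega, (\val @` Wad) (w : L0 R Omega) ->
       PVh w = PWh w)
    (A7 : [/\ closed Zad, convex_set Zad & bounded_set Zad])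
    (A7' : forall w u, Wh w -> E u w -> (\val @` Zad) (emb u * w))
    (A8 : [/\ closed Ztau, convex_set Ztau & bounded_set Ztau])
    (A8' : forall z, Ztau z -> piecewise_constant Qtau z)
    (A8'' : forall w u, Wh w -> Etau u w ->
       (\val @` Ztau) (Ptau (emb u) * Ptau w)),
  let D_I := I_feasible emb Qtau A f0 f1 Wh in
  let D_McC := McC_feasible emb Qtau A f0 f1 uli uui wli wui Wh (\val @` Ztau) in
  let J u := tracking_objective T emb2 ydelta u in
  let J_I (uw : U * L0 R Omega) := J uw.1 in
  let J_McC (uwz : U * L0 R Omega * L0 R Omega) := J uwz.1.1 in
  [/\ convex_minimization_problem D_McC J_McC,
      exists uwz, is_minimizer D_McC J_McC uwz &
      forall u w, D_I (u, w) ->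
        let z := Ptau (emb u) * Ptau w in
        [/\ Wh w, (\val @` Ztau) z, D_McC (u, w, z) &
            J_McC (u, w, z) = J_I (u, w)]].
Proof.
move=> mu Ptau emb E Etau Wh PVhP PWhP ul uu uli uui wli wui Zad Ztau.
move=> [_ _ Vfin] A2 _ A4 A5 _ _ _ [Zcl Zcvx Zbd] Zpw ZP D_I D_McC J J_I J_McC.
have muT : mu setT \is a fin_num := domain_measure_fin Omega.
have [lA cA [g [Ag gA cg]]] := A_iso.
have lg : linear g := linear_inv lA Ag gA.
have le2 : linear emb2 by move=> a u v; rewrite linearP.
have lep : linear embp by move=> a u v; rewrite linearP.
have lT : linear T by move=> a u v; rewrite linearP.
have lemb : linear emb by move=> a u v; rewrite /emb le2; exact: val_linear.
have avgL q (q1 : (1 <= q)%E) i :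
    linear (fun v : Lp Omega q1 => cell_average Qtau v i : R^o).
  move=> a v w; have := val_linear a v w => /= ->.
  by apply: cell_average_linear; exact: Lspace_integrable.
(* The admissible controls are viewed in L^2, where [PWhP] gives closedness, [Wad_bound] gives
   boundedness and [Vfin] a finite spanning family. *)
pose W2 : set (L2 Omega) := [set v : L2 Omega | Wh v].
have [m [bw [K [cK WK]]]] : exists m (bw : 'I_m -> L2 Omega) (K : set 'rV[R]_m),
    compact K /\ W2 = lin_comb bw @` K.
  apply: finite_dimensional_compact.
  - exact: metric_projection_closed PWhP.
  - have [C hC] := L2_norm_bound (`|wl| + `|wu|) muT.
    apply/bounded_setP; exists C => v [[w Wadw wv] _]; apply: hC.
    apply: (filterS3 _ _ (Wad_bound w Wadw) (Loo_ae_bound wl) (Loo_ae_bound wu)) => x.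
    rewrite -wv => /andP[lw wu'] hl hu; rewrite ler_norml.
    rewrite (le_trans _ lw) ?(le_trans wu')//.
      by rewrite (le_trans (ler_norm _))// (le_trans hu)// lerDr.
    by rewrite lerNl (le_trans (ler_norm _))// normrN (le_trans hl)// lerDl.
  - have [n [b Vb]] := Vfin; exists n, b => v [_ [v' Vv' vv']].
    by rewrite -(val_inj vv'); exact: Vb.
have [k [bz [D [cD ZD]]]] := finite_dimensional_compact Zcl Zbd
  (piecewise_constant_ansatz Zpw).
(* [F] and [G] send coordinates to controls and product variables as classes of functions;
   compactness and continuity are argued on coordinates. *)
pose F (c : 'rV[R]_m) : L0 R Omega := lin_comb bw c.
pose G (e : 'rV[R]_k) : L0 R Omega := lin_comb bz e.
have lF : linear F by move=> a c c'; rewrite /F lin_comb_linear; exact: val_linear.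
have lG : linear G by move=> a c c'; rewrite /G lin_comb_linear; exact: val_linear.
have WhF : Wh = F @` K.
  apply/seteqP; split=> [w Whw|_ [c Kc <-]]; last first.
    have : W2 (lin_comb bw c) by rewrite WK; exists c.
    exact.
  have [_ [v _ vw]] := Whw.
  have : W2 v by rewrite /W2/= -[X in Wh X]/(val v) vw.
  by rewrite WK => -[c Kc cv]; exists c => //; rewrite -vw /F cv.
have hullF : convex_hull Wh = F @` convex_hull K by rewrite WhF convex_hull_image.
have ZG : \val @` Ztau = G @` D.
  apply/seteqP; split=> [_ [z Zz <-]|_ [e De <-]].
    by move: Zz; rewrite ZD => -[e De <-]; exists e.
  by exists (lin_comb bz e) => //; rewrite ZD; exists e.
(* The representing functional is unique, so a choice of it is linear in e. *)
have /choice[Phi PhiP] e : exists phi, represents emb (f0 * G e) phi.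
  exact: (represents_exists (lin_comb bz e) lep embp_cont embE f0_fin).
have lPhi : linear Phi.
  move=> a e e'; apply: represents_uniq (PhiP _) _.
  by rewrite lG L0_mulrD; exact: represents_linear.
(* As [g] inverts [A], this is the only state that solves the equation with [G e]. *)
pose S e := g (f1 - Phi e).
have SP u e : state_equation emb A f0 f1 u (G e) <-> u = S e.
  split=> [[phi phiP uE]|->]; last by exists (Phi e) => //; rewrite gA subrK.
  by rewrite /S -uE (represents_uniq phiP (PhiP e)) addrK Ag.
have SE e : S e = g f1 - g (Phi e).
  by rewrite /S -{1}[f1]scale1r -scaleN1r linear_combination2// scale1r scaleN1r.
(* The composite of [q], [g] and [Phi] is linear on a finite-dimensional space, hence continuous. *)
have hS (V : normedModType R) (q : U -> V) : linear q -> continuous (q \o S).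
  move=> lq; rewrite (_ : q \o S = fun e => q (g f1) - q (g (Phi e))); last first.
    apply/funext => e; rewrite /= SE -[g f1]scale1r -scaleN1r.
    by rewrite linear_combination2// !scale1r scaleN1r.
  move=> e; apply: (@cvgB _ _ _ (nbhs e)); first exact: cvg_cst.
  apply: (@linear_rV_continuous _ _ _ (fun e => q (g (Phi e)))) => a x y.
  by rewrite lPhi lg lq.
have Zpw' z : (\val @` Ztau) z -> piecewise_constant Qtau z.
  by move=> [z' Zz' <-]; exact: Zpw.
pose ua i e : R := cell_average Qtau (emb (S e)) i.
pose wa i c : R := cell_average Qtau (F c) i.
pose za i e : R := cell_average Qtau (G e) i.
have cua i : continuous (ua i).
  apply: (hS R^o (fun u => cell_average Qtau (emb u) i)) => a u v.
  by rewrite lemb; apply: cell_average_linear; exact: Lspace_integrable.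
have cwa i : continuous (wa i).
  apply: (@linear_rV_continuous _ _ R^o) => a x y; rewrite /wa lF.
  by apply: cell_average_linear; exact: Lspace_integrable.
have cza i : continuous (za i).
  apply: (@linear_rV_continuous _ _ R^o) => a x y; rewrite /za lG.
  by apply: cell_average_linear; exact: Lspace_integrable.
(* The state is determined by [e], so the coordinates of [w] and [z] describe a feasible triple. *)
pose DD : set ('rV[R]_m * 'rV[R]_k) := (convex_hull K `*` D) `&`
  \bigcap_i [set ce | mccormick (uli i) (uui i) (wli i) (wui i)
    (ua i ce.2) (wa i ce.1) (za i ce.2)].
have DDP u w z : D_McC (u, w, z) <->
    exists2 ce, DD ce & (u, w, z) = (S ce.2, F ce.1, G ce.2).
  split=> [[uz muwz]|[[c e] [[/= Kc De] mce] [-> -> ->]]].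
    rewrite hullF => -[c Kc cw] Zz; move: (Zz); rewrite ZG => -[e De ez].
    have uE : u = S e by apply/SP; rewrite ez.
    exists (c, e); last by rewrite /= uE cw ez.
    split=> // i _ /=; rewrite /ua /wa /za -uE cw ez.
    by apply/mccP; [exact: Zpw'|exact: muwz].
  have Ze : (\val @` Ztau) (G e) by rewrite ZG; exists e.
  split=> //; first exact/SP; last by rewrite hullF; exists c.
  by move=> i; apply/mccP; [exact: Zpw'|exact: mce].
have feas u w : D_I (u, w) ->
    [/\ Wh w, (\val @` Ztau) (Ptau (emb u) * Ptau w),
        D_McC (u, w, Ptau (emb u) * Ptau w) &
        J_McC (u, w, Ptau (emb u) * Ptau w) = J_I (u, w)].
  (* With [z] equal to the product of the averages, both problems have the same state equation. [ZP]
     puts [z] into [Ztau], and the McCormick inequalities follow from the bounds [A4] and [A5]. *)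
  move=> [/= Eu Ww]; have Zz := ZP _ _ Ww Eu; split => //; split => //.
    move=> i; apply: mcc_product; last exact: A5.
    by have [[w' Wadw' ww'] _] := Ww; apply: (A4 w' u Wadw'); rewrite -ww' in Eu.
  exact: (sub_convex_hull Ww).
split; last exact: feas.
- split; last by apply: normB_convex; move=> a x y; rewrite /= le2 lT.
  apply/convex_setP => t [[u w] z] [[u' w'] z'] t0 t1 D1 D2.
  rewrite -[X in D_McC X]/(t *: u + (1 - t) *: u', t *: w + (1 - t) *: w',
    t *: z + (1 - t) *: z').
  have [[phi phiP phiE] m1 h1 Z1] := D1.
  have [[psi psiP psiE] m2 h2 Z2] := D2.
  have Z3 : (\val @` Ztau) (t *: z + (1 - t) *: z').
    have [v Zv vz] := Z1; have [v' Zv' vz'] := Z2.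
    exists (t *: v + (1 - t) *: v').
      by move/convex_setP: Zcvx; apply.
    by rewrite -vz -vz'; exact: (linear_combination2 _ _ _ _ (@val_linear _ _ _ _ _ _)).
  split=> //; last by move/convex_setP: (@convex_hull_convex _ _ Wh); apply.
    (* Products with [f0] depend linearly on [z], so the mixed functional represents [f0] times the
       mixed [z]. *)
    exists (t *: phi + (1 - t) *: psi).
      rewrite (linear_combination2 (f := fun z => f0 * z))//.
        exact: represents_combination2.
      by move=> a x y; exact: L0_mulrD.
    rewrite (linear_combination2 (f := A))// addrACA -!scalerDr phiE psiE -scalerDl.
    by rewrite addrC subrK scale1r.
  move=> i; apply/mccP; first exact: Zpw'.
  have := m1 i; have := m2 i.
  move=> /(mccP _ _ _ _ _ _ _ (Zpw' _ Z2)) M2 /(mccP _ _ _ _ _ _ _ (Zpw' _ Z1)) M1.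
  have {}M1 := mccormick_convex t0 t1 M1 M2.
  (* Linearity of the averages rests on integrability. Hull elements are therefore written as values
     of [F], which come from L^2, and elements of the image of [Ztau] as bounded functions. *)
  have avg2 (q : \bar R) (q1 : (1 <= q)%E) (v v' : Lp Omega q1) :
      cell_average Qtau (t *: (v : L0 R Omega) + (1 - t) *: (v' : L0 R Omega)) i =
      t * cell_average Qtau v i + (1 - t) * cell_average Qtau v' i.
    have := linear_combination2 t (1 - t) v v' (avgL _ q1 i).
    by rewrite (linear_combination2 _ _ _ _ (@val_linear _ _ _ _ _ _)).
  move: h1 h2 Z1 Z2 M1; rewrite hullF => -[c _ <-] [c' _ <-] [v _ <-] [v' _ <-].
  by rewrite -!avg2 (linear_combination2 (f := emb)).
have DD0 : DD !=set0.
  (* The projection of 0 lies in [Wh]. By [A2] it has a state, and [feas] turns the pair into a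
     feasible triple. *)
  have [Ww _] := PWhP 0; have [[w' Wadw' ww'] _] := Ww.
  have [_ [u [Eu _]]] := A2 _ Wadw'.
  have Eu' : Etau u (PWh 0) := eq_ind _ (Etau u) Eu _ ww'.
  have [_ _ /DDP[ce DDce _] _] := feas u _ (conj Eu' Ww).
  by exists ce.
have cDD : compact DD.
  apply: compact_closedI; first by apply: compact_setX => //; exact: convex_hull_compact.
  apply: closed_bigI => i _; apply: closed_mccormick => ce.
  - by apply: (@continuous_comp _ _ _ snd (ua i)); [exact: cvg_snd|exact: cua].
  - by apply: (@continuous_comp _ _ _ fst (wa i)); [exact: cvg_fst|exact: cwa].
  - by apply: (@continuous_comp _ _ _ snd (za i)); [exact: cvg_snd|exact: cza].
have cJ : {within DD, continuous (fun ce : 'rV[R]_m * 'rV[R]_k => J (S ce.2))}.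
  apply: continuous_subspaceT => ce.
  apply: (@continuous_comp _ _ _ snd (fun e => J (S e))); first exact: cvg_snd.
  apply: (@continuous_comp _ _ _ _ (fun y : Y => `|y|)); last exact: norm_continuous.
  apply: (@cvgB _ _ _ (nbhs ce.2)); last exact: cvg_cst.
  by apply: (hS Y (T \o emb2)) => a x y; rewrite /= le2 lT.
(* By [DDP] every feasible triple has coordinates in [DD], so a minimizer over the compact set [DD]
   gives a minimizer of the relaxation. *)
have [[c e] /set_mem DDce cmin] := compact_EVT_min DD0 cDD cJ.
exists (S e, F c, G e); split; first by apply/DDP; exists (c, e).
move=> [[u w] z] /DDP[ce DDce' [-> _ _]].
by apply: cmin; exact: mem_set.
Qed.
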